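(* Let $(M,g)$ be a complete Riemannian manifold (possibly infinite-dimensional) which is uniformly bumpable, and let $F:M\to (-\infty,+\infty]$ be a lower semicontinuous function that is bounded below, $F\not\equiv+\infty$. Then, for every $\delta>0$ there exists a bounded $C^1$ smooth function $\varphi:M\to\mathbb{R}$ such that: (1) $F-\varphi$ attains its strong minimum in $M$; (2) $\|\varphi\|_{\infty}:=\sup_{p\in M}|\varphi(p)|<\delta$, and $\|d\varphi\|_{\infty}:=\sup_{p\in M}\|d\varphi(p)\|_{p}<\delta$.
   Context: A Riemannian manifold $(M,g)$ is a $C^\infty$ manifold modelled on a Hilbert space (possibly infinite-dimensional) with a $C^\infty$ assignment of scalar products $\langle\cdot,\cdot\rangle_p$ on the tangent spaces $TM_p$ whose norms $\|\cdot\|_p$ are equivalent to the Hilbert norm; $d$ is the Riemannian distance, and completeness is with respect to $d$. The norm of a differential is $\|d\varphi(p)\|_p=\sup\{d\varphi(p)(v): v\in TM_p, \|v\|_p\le1\}$. $M$ is uniformly bumpable if there exist numbers $R>1$ and $r>0$ such that for every $p\in M$, $\delta\in(0,r)$ there exists a $C^1$ smooth function $b:M\to[0,1]$ such that $b(p)=1$; $b(x)=0$ if $d(x,p)\ge\delta$; and $\sup_{x\in M}\|db(x)\|_x\le R/\delta$. A function $G:M\to\mathbb{R}\cup\{+\infty\}$ attains a strong minimum at $p$ if $G(p)=\inf_{x\in M}G(x)$ and $\lim_{n\to\infty}d(p_n,p)=0$ whenever $(p_n)$ is a sequence with $\lim_{n\to\infty}G(p_n)=G(p)$. *)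

(* Defs.v *)
From HB Require Import structures.
From mathcomp Require Import all_boot all_order all_algebra sesquilinear.
From mathcomp Require Import all_classical all_reals all_analysis.

Set Implicit Arguments.
Unset Strict Implicit.
Unset Printing Implicit Defensive.

Import Order.TTheory GRing.Theory Num.Theory.
Import numFieldNormedType.Exports.

Local Open Scope classical_set_scope.
Local Open Scope ring_scope.

Section smoothness.
Context {R : realType} {E F : normedModType R}.

Definition unit_args n (vs : seq E) : Prop :=
  size vs = n /\ all (fun v => `|v| <= 1) vs.

(* A function on E^n is encoded as a function on sequences, of which only the
   values on sequences of size n matter. *)
Definition bounded_multilinear n (B : seq E -> F) : Prop :=
  (forall (vs : seq E) (i : nat) (a : R) (u v : E), size vs = n -> (i < n)%N ->
     B (set_nth 0 vs i (a *: u + v)) =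
     a *: B (set_nth 0 vs i u) + B (set_nth 0 vs i v)) /\
  (exists C : R, forall vs : seq E, unit_args n vs -> `|B vs| <= C).

(* If A takes values in the bounded n-linear maps E^n -> F, its derivative takes
   values in L(E, L^n(E; F)) = L^(n+1)(E; F); the new argument comes first. *)
Definition mder (A : E -> seq E -> F) (x : E) (vs : seq E) : F :=
  'd (A^~ (behead vs)) x (head 0 vs).

(* A is a C^k map, in the sense of Frechet, from the open set U to L^n(E; F)
   with the operator norm. *)
Fixpoint Ck_multi (k n : nat) (U : set E) (A : E -> seq E -> F) : Prop :=
  (forall x, U x -> bounded_multilinear n (A x)) /\
  match k with
  | 0 => forall x, U x -> forall e : R, 0 < e ->
      \forall y \near x, forall vs, unit_args n vs -> `|A y vs - A x vs| <= e
  | k'.+1 =>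
      (forall x, U x -> forall e : R, 0 < e ->
         \forall h \near (0 : E), forall vs, unit_args n vs ->
           `|A (x + h) vs - A x vs - mder A x (h :: vs)| <= e * `|h|) /\
      Ck_multi k' n.+1 U (mder A)
  end.

Definition Ck (k : nat) (U : set E) (f : E -> F) : Prop :=
  Ck_multi k 0 U (fun x _ => f x).

Definition Csmooth (U : set E) (f : E -> F) : Prop := forall k, Ck k U f.

End smoothness.

(* The norm of H is induced by the inner product ip; together with the
   completeness of H this makes H a real Hilbert space. *)
Definition induces_norm (R : realType) (H : normedModType R)
    (ip : {dot H for idfun}) : Prop :=
  forall x : H, ip x x = `|x| ^+ 2.

(* The maps chart i and chart_inv i are total, but only meaningful on
   chart_dom i and on its image. *)
Record manifold (R : realType) (H : normedModType R) (M : topologicalType) :=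
  Manifold {
  chart_index : Type;
  chart_dom : chart_index -> set M;
  chart : chart_index -> M -> H;
  chart_inv : chart_index -> H -> M;
  chart_at : M -> chart_index;
  manifold_hausdorff : hausdorff_space M;
  chart_dom_open : forall i, open (chart_dom i);
  chart_img_open : forall i, open (chart i @` chart_dom i);
  chart_at_dom : forall p, chart_dom (chart_at p) p;
  chartK : forall i, {in chart_dom i, cancel (chart i) (chart_inv i)};
  chart_continuous : forall i, {within chart_dom i, continuous (chart i)};
  chart_inv_continuous : forall i,
    {within chart i @` chart_dom i, continuous (chart_inv i)};
  chart_transition : forall i j,
    Csmooth (chart i @` (chart_dom i `&` chart_dom j))
            (chart j \o chart_inv i)
}.

Section riemannian.
Context {R : realType} {H : normedModType R} {M : topologicalType}.
Variable X : manifold H M.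

Definition chart_img (i : chart_index X) : set H := chart i @` chart_dom i.

(* The tangent space at p is identified with H by means of the chart
   chart_at X p. This is the tangent vector at the point of coordinate y in the
   chart i which is represented by v in that chart. *)
Definition tangent_of_coord (i : chart_index X) (y : H) (v : H) : H :=
  'd (chart (chart_at X (chart_inv i y)) \o chart_inv i) y v.

Definition local_metric (g : M -> {dot H for idfun}) (i : chart_index X)
    (y : H) (vs : seq H) : R :=
  g (chart_inv i y) (tangent_of_coord i y (nth 0 vs 0))
                    (tangent_of_coord i y (nth 0 vs 1)).

Record riemannian_metric := RiemannianMetric {
  metric :> M -> {dot H for idfun};
  metric_equiv : forall p, exists2 C : R, 0 < C & forall v : H,
    C^-1 * `|v| <= Num.sqrt (metric p v v) <= C * `|v|;
  metric_smooth : forall (i : chart_index X) (k : nat),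
    Ck_multi (F := R^o) k 2 (chart_img i) (local_metric metric i)
}.

Variable g : riemannian_metric.

Definition tnorm (p : M) (v : H) : R := Num.sqrt (g p v v).

Definition C1_function (f : M -> R) : Prop :=
  forall i : chart_index X,
    Ck (F := R^o) 1 (chart_img i) (f \o chart_inv i).

Definition differential (f : M -> R) (p : M) (v : H) : R :=
  'd (f \o chart_inv (chart_at X p) : H -> R^o) (chart (chart_at X p) p) v.

Definition differential_norm (f : M -> R) (p : M) : \bar R :=
  ereal_sup [set (differential f p v)%:E | v in [set v | tnorm p v <= 1]].

Definition C1_curve (c : R -> M) : Prop :=
  continuous c /\
  forall i : chart_index X,
    Ck (E := R^o) 1 (c @^-1` chart_dom i) (chart i \o c).

(* A curve is C^1 on a compact interval if it agrees there with a curve that is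
   C^1 on the real line. *)
Definition piecewise_C1 (c : R -> M) (a b : R) : Prop :=
  exists2 s : seq R, itv_partition a b s &
    forall k, (k < size s)%N -> exists2 c' : R -> M, C1_curve c' &
      {in `[nth b (a :: s) k, nth b s k], c =1 c'}.

Definition velocity (c : R -> M) (t : R) : H :=
  derive1 (chart (chart_at X (c t)) \o c) t.

Definition curve_length (c : R -> M) (a b : R) : \bar R :=
  (\int[lebesgue_measure]_(t in `[a, b]) (tnorm (c t) (velocity c t))%:E)%E.

(* +oo when p and q lie in different connected components. *)
Definition riemannian_dist (p q : M) : \bar R :=
  ereal_inf [set l | exists (c : R -> M) (a b : R),
    [/\ a <= b, piecewise_C1 c a b, c a = p, c b = q
      & l = curve_length c a b]].

Definition riemannian_complete : Prop :=
  forall u : nat -> M,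
    (forall e : R, 0 < e -> exists N : nat, forall m n : nat,
       (N <= m)%N -> (N <= n)%N -> (riemannian_dist (u m) (u n) < e%:E)%E) ->
    exists l : M, riemannian_dist (u n) l @[n --> \oo] --> 0%E.

Definition uniformly_bumpable : Prop :=
  exists K r : R, [/\ 1 < K, 0 < r &
    forall (p : M) (delta : R), 0 < delta < r ->
    exists b : M -> R, [/\ C1_function b,
      forall x, 0 <= b x <= 1,
      b p = 1,
      forall x, (delta%:E <= riemannian_dist x p)%E -> b x = 0 &
      (ereal_sup (range (differential_norm b)) <= (K / delta)%:E)%E]].

Definition strong_minimum (G : M -> \bar R) (p : M) : Prop :=
  G p = ereal_inf (range G) /\
  forall u : nat -> M, G (u n) @[n --> \oo] --> G p ->
    riemannian_dist (u n) p @[n --> \oo] --> 0%E.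

End riemannian.

(* Main.v *)
Require Import Defs.
From HB Require Import structures.
From mathcomp Require Import all_boot all_order all_algebra sesquilinear.
From mathcomp Require Import all_classical all_reals all_analysis.
From mathcomp Require Import measurable_realfun ring lra.
Import Order.TTheory GRing.Theory Num.Theory.
Import numFieldNormedType.Exports.
Local Open Scope classical_set_scope.
Local Open Scope ring_scope.

(** * A smooth variational principle on Riemannian manifolds

    A small C^1 perturbation with a minimum is the sum of a series of bumps.
    Start from [F]; at step [n], choose an approximate minimizer [p n] of [F]
    minus the bumps chosen so far, and subtract a bump of centre [p n], radius
    [rho / 2^n] and height [al / 8^n]. If the approximation error is half this
    height, all later approximate minimizers have to lie in the support of this
    bump. Uniform bumpability makes the gradient of the n-th bump of order
    [1 / 4^n], so that the series converges in C^1 and its sum is small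
    together with its gradient (lemmas [C1_function_limit] and [bump_series]).
    The points [p n] form a Cauchy sequence for the Riemannian distance, and
    by completeness they converge to some [l]; lower semicontinuity makes [l] a
    minimizer of the perturbed function (lemma [perturbed_minimum]). The
    minimum becomes strong after subtracting a second series, whose bumps are
    all centred at [l]: a point outside the n-th ball loses at least a fixed
    fraction of the height of the n-th bump (lemma [strong_maximum_function]).

    Two points of this argument need the geometry of the distance. The Cauchy
    property holds with the distances in both orders, whereas bumps only
    control the distance to their centre: hence the symmetry of the distance,
    by reversal of curves (lemma [riemannian_distC]). And semicontinuity refers
    to the topology of the manifold, in which the [p n] must converge to [l]:
    points that are close to [l] for the distance lie in a given neighbourhood
    of [l] (lemma [riemannian_dist_nbhs]). For this, a curve ending at [l] is
    followed backwards in a chart. Its length dominates its displacement, as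
    long as it stays over a small ball on which the metric is bounded below;
    and it cannot leave this ball without having the length of a radius,
    because its coordinates converge at the exit time by completeness of the
    model space, and their limit determines the exit point as the manifold is
    Hausdorff. *)

Set Implicit Arguments.
Unset Strict Implicit.
Unset Printing Implicit Defensive.

(** * Differentiability in normed spaces *)

Section calculus.
Context {R : realType} {E F : normedModType R}.
Implicit Types (f g : E -> F) (x : E) (U : set E).

Lemma linear_unit_bound (L : {linear E -> F}) (C : R) :
  (forall v, `|v| <= 1 -> `|L v| <= C) -> forall v, `|L v| <= C * `|v|.
Proof.
move=> LC v; have [->|v0] := eqVneq v 0; first by rewrite linear0 !normr0 mulr0.
have nv0 : 0 < `|v| by rewrite normr_gt0.
have /LC : `|(`|v|^-1 *: v)| <= 1.
  by rewrite normrZ ger0_norm ?invr_ge0// mulVf// gt_eqF.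
by rewrite linearZ normrZ ger0_norm ?invr_ge0// ler_pdivrMl// mulrC.
Qed.

Lemma linear_bound_continuous (L : {linear E -> F}) (C : R) :
  (forall v, `|L v| <= C * `|v|) -> continuous L.
Proof.
move=> LC; apply: bounded_linear_continuous; apply/linear_boundedP.
near=> k => v; apply: le_trans (LC v) _; apply: ler_wpM2r => //.
Unshelve. all: by end_near. Qed.

Lemma diff_approx f x : differentiable f x -> forall e : R, 0 < e ->
  \forall h \near 0, `|f (x + h) - f x - 'd f x h| <= e * `|h|.
Proof.
move=> /diff_locally /eqaddoP fx e e0; have /= := fx e e0.
by apply: filterS => h; rewrite !fctE /= opprD addrA [h + x]addrC.
Qed.

Lemma approx_diff f x (L : {linear E -> F}) : continuous L ->
  (forall e : R, 0 < e ->
     \forall h \near 0, `|f (x + h) - f x - L h| <= e * `|h|) ->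
  differentiable f x /\ 'd f x = L :> (E -> F).
Proof.
move=> cL fL; have fxL : f \o shift x = cst (f x) + L +o_ 0 id.
  apply/eqaddoP => e e0 /=; have := fL e e0.
  by apply: filterS => h; rewrite !fctE /= opprD addrA [h + x]addrC.
have dL := diff_unique cL fxL; split => //.
by apply/diff_locallyP; rewrite dL; split.
Qed.

(** Expressions of one function in two charts agree only near a point, hence
    the local form. *)
Lemma diff_near_eq f g x : (\forall y \near x, f y = g y) ->
  differentiable f x -> differentiable g x /\ 'd g x = 'd f x :> (E -> F).
Proof.
move=> fg df; apply: approx_diff => [|e e0]; first exact: diff_continuous.
have fg0 : \forall h \near 0, f (x + h) = g (x + h).
  have : (fun h => x + h) @ (0 : E) --> x + 0 by apply: cvgD; [exact: cvg_cst|].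
  by rewrite addr0 => /(_ _ fg).
rewrite -(nbhs_singleton fg); have := diff_approx df e0.
by move: fg0; apply: filterS2 => h ->.
Qed.

Lemma diff_sub f g x v : differentiable f x -> differentiable g x ->
  'd (f \- g) x v = 'd f x v - 'd g x v.
Proof. by move=> df dg; rewrite (diffB df dg). Qed.

(** Being of class C^1 in the sense of iterated multilinear derivatives is
    being differentiable with a norm-continuous derivative. *)
Lemma Ck1P U f : Ck 1 U f <-> forall x, U x -> differentiable f x /\
  forall e : R, 0 < e -> \forall y \near x,
    forall v, `|v| <= 1 -> `|'d f y v - 'd f x v| <= e.
Proof.
split=> [[_ [dU [bU cU]]] x Ux|fU].
- have [_ [C bC]] := bU x Ux.
  have cdf : continuous ('d f x).
    apply: (@linear_bound_continuous _ C); apply: linear_unit_bound => v v1.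
    by have := bC [:: v]; apply; split => //=; rewrite v1.
  split=> [|e e0].
    apply: (fun h => proj1 (approx_diff cdf h)) => e e0.
    by apply: filterS (dU x Ux e e0) => h /(_ [::]); apply.
  apply: filterS (cU x Ux e e0) => y yx v v1.
  by have := yx [:: v]; apply; split => //=; rewrite v1.
- split=> [x Ux|]; first by split=> //; exists `|f x| => vs _.
  split=> [x Ux e e0|].
    have [df _] := fU x Ux.
    by apply: filterS (diff_approx df e0) => h hP vs _.
  split=> [x Ux|x Ux e e0].
    have [df _] := fU x Ux; split.
      move=> vs i a u v; case: vs => [//|w [|//]] _; case: i => [_|//] /=.
      by rewrite /mder /= linearP.
    have [k k0 kP] := linear_lipschitz (diff_continuous df).
    exists k => vs []; case: vs => [//|v [|//]] _ /=; rewrite andbT => v1.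
    rewrite /mder /=; apply: le_trans (kP v) _.
    by rewrite ler_piMr// ltW.
  have [_ /(_ e e0)] := fU x Ux; apply: filterS => y yx vs [].
  case: vs => [//|v [|//]] _ /=; by rewrite andbT /mder /= => /yx.
Qed.

End calculus.

Section calculus_real.
Context {R : realType} {E : normedModType R}.
Implicit Types (f : E -> R^o) (x : E).

Lemma ball_segment x r (a b : E) (t : R) : ball x r a -> ball x r b ->
  0 <= t <= 1 -> ball x r (a + t *: (b - a)).
Proof.
rewrite -!ball_normE /= => xa xb /andP[t0 t1].
have -> : x - (a + t *: (b - a)) = (1 - t) *: (x - a) + t *: (x - b).
  rewrite scalerBl scale1r -addrA -scalerN -scalerDr opprB addrA subrK.
  by rewrite opprD addrA -scalerN opprB.
apply: le_lt_trans (ler_normD _ _) _; rewrite !normrZ.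
rewrite !ger0_norm ?subr_ge0//.
have [->|t0'] := eqVneq t 0; first by rewrite subr0 mul1r mul0r addr0.
have tp : 0 < t by rewrite lt_neqAle eq_sym t0'.
have : t * `|x - b| < t * r by rewrite ltr_pM2l.
have : (1 - t) * `|x - a| <= (1 - t) * r by rewrite ler_wpM2l ?subr_ge0// ltW.
lra.
Qed.

(** The mean value theorem on the segment from [a] to [b]. *)
Lemma mean_value_ball f x (r K : R) :
  (forall y, ball x r y -> differentiable f y) ->
  (forall y v, ball x r y -> `|'d f y v| <= K * `|v|) ->
  forall a b, ball x r a -> ball x r b -> `|f b - f a| <= K * `|b - a|.
Proof.
move=> df dK a b xa xb.
pose p (t : R) := a + t *: (b - a).
have dp (t : R) : is_diff (t : R^o) (p : R^o -> E) (fun h => h *: (b - a)).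
  rewrite /p -[X in is_diff _ _ X]add0r.
  by apply: is_diffD; exact: is_diff_scalel.
have dfp (t : R) : 0 <= t <= 1 ->
    is_derive (t : R^o) (1 : R^o) (f \o p) ('d f (p t) (b - a)).
  move=> t01; have dft : differentiable f (p t) by apply/df/ball_segment.
  have [dpt dpE] := dp t.
  have dc : differentiable (f \o p) (t : R^o) by exact: differentiable_comp.
  apply: DeriveDef; first exact: diff_derivable.
  by rewrite deriveE// diff_comp// dpE /= scale1r.
have [c c01 E1] : exists2 c : R, c \in `[0, 1]%R &
    (f \o p) 1 - (f \o p) 0 = 'd f (p c) (b - a) * (1 - 0).
  apply: (@MVT_segment R (f \o p) (fun t => 'd f (p t) (b - a))) => //.
    by move=> t; rewrite in_itv/= => /andP[t0 t1]; apply: dfp; rewrite !ltW.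
  apply: derivable_within_continuous => t; rewrite in_itv/= => t01.
  by have [] := dfp t t01.
move: E1; rewrite /= /p scale1r scale0r addr0 subr0 mulr1 [a + _]addrC subrK => ->.
by apply/dK/ball_segment => //; rewrite in_itv/= in c01.
Qed.

End calculus_real.

(** * Limits of C^1 functions *)

Section C1_limit.
Context {R : realType} {E : normedModType R}.

Lemma linear_limit (L : nat -> {linear E -> R^o}) (l : E -> R^o) :
  (forall v, L n v @[n --> \oo] --> l v) ->
  exists l' : {linear E -> R^o}, l' = l :> (E -> R^o).
Proof.
move=> Ll; have llin : linear l.
  move=> a u v.
  apply: (@cvg_unique _ (@norm_hausdorff _ R^o) _ _ _ _ (Ll (a *: u + v))).
  have -> : (fun n => L n (a *: u + v)) = fun n => a *: L n u + L n v.
    by apply/funext => n; rewrite linearP.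
  exact: (cvgD (cvgZl_tmp (k := a) (Ll u)) (Ll v)).
pose l' := HB.pack_for {linear E -> R^o} l
  (GRing.isLinear.Build _ _ _ _ l llin).
by exists l'.
Qed.

Lemma dist_le_third (a b c z d : R) : `|a - b| <= d / 3 -> `|b - c| <= d / 3 ->
  `|c - z| <= d / 3 -> `|a - z| <= d.
Proof.
move=> ab bc cz; rewrite (le_trans (ler_distD b a z))//.
have := ler_distD c b z; lra.
Qed.

Lemma cvg_dist_le (u : R^nat) (l a c : R) (n : nat) : u @ \oo --> l ->
  (forall m, (n <= m)%N -> `|u m - a| <= c) -> `|l - a| <= c.
Proof.
move=> ul uc; have ua : `|u m - a| @[m --> \oo] --> `|l - a|.
  by apply: cvg_norm; apply: cvgB => //; exact: cvg_cst.
apply: (@closed_cvg _ _ _ eventually_filter _ [set t | t <= c] _ _ _ ua).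
  exact: closed_le.
by exists n.
Qed.

Lemma cauchy_rate_cvg (u : R^nat) (e : R^nat) : e @ \oo --> 0 ->
  (forall m n, (n <= m)%N -> `|u m - u n| <= e n) -> cvgn u.
Proof.
move=> e0 ue; apply/cauchy_cvgP/cauchy_ballP => _/posnumP[d].
have d2 : 0 < d%:num / 2 by [].
have [n _ en] : \forall n \near \oo, `|e n| < d%:num / 2.
  have /cvgrPdist_lt /(_ _ d2) := e0.
  by apply: filterS => n; rewrite sub0r normrN.
have un m : (n <= m)%N -> `|u m - u n| < d%:num / 2.
  move=> nm; apply: le_lt_trans (ue _ _ nm) _.
  exact: le_lt_trans (ler_norm _) (en n (leqnn n)).
pose tail := [set u m | m in [set m | (n <= m)%N]].
exists (tail, tail).
  by split; exists n => // m nm; exists m.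
move=> [_ _] [[p np <-] [q nq <-]] /=; rewrite /ball /= /ball_ /=.
rewrite -(subrKA (u n)) (le_lt_trans (ler_normD _ _))//.
rewrite (splitr d%:num) ltrD ?un// distrC un//.
Qed.

(** The uniform limit theorem for derivatives: on a ball, the error of the
    n-th function is Lipschitz with constant [e n], by the mean value
    inequality for the differences of the sequence; so the first-order
    remainder of the limit exceeds that of the n-th function by at most
    [2 * e n] times the increment. *)
Lemma C1_limit_ball (s : nat -> E -> R^o) (f : E -> R^o) x (r : R) (e : R^nat) :
  0 < r ->
  (forall n y, ball x r y -> differentiable (s n) y) ->
  (forall n (d : R), 0 < d -> \forall y \near x,
     forall v, `|v| <= 1 -> `|'d (s n) y v - 'd (s n) x v| <= d) ->
  (forall y, ball x r y -> s n y @[n --> \oo] --> f y) ->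
  (forall m n y v, (n <= m)%N -> ball x r y ->
     `|'d (s m \- s n) y v| <= e n * `|v|) ->
  e @ \oo --> 0 ->
  (forall y, ball x r y -> differentiable f y /\
     forall v, 'd (s n) y v @[n --> \oo] --> 'd f y v) /\
  (forall d : R, 0 < d -> \forall y \near x,
     forall v, `|v| <= 1 -> `|'d f y v - 'd f x v| <= d).
Proof.
move=> r0 ds cs sf dsB e0.
have dse m n y v : (n <= m)%N -> ball x r y ->
    `|'d (s m) y v - 'd (s n) y v| <= e n * `|v|.
  by move=> nm xy; rewrite -diff_sub; [exact: dsB|exact: ds|exact: ds].
have e_small (d : R) : 0 < d -> exists n, e n <= d.
  move=> d0; have /cvgrPdist_le /(_ d d0) [n _ /(_ n (leqnn n))] := e0.
  by rewrite /= sub0r normrN => /(le_trans (ler_norm _)); exists n.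
have main y : ball x r y -> differentiable f y /\
    forall v, 'd (s n) y v @[n --> \oo] --> 'd f y v.
  move=> xy.
  have dcvg v : cvgn (fun n => 'd (s n) y v).
    apply: (@cauchy_rate_cvg _ (fun n => e n * `|v|)).
      by rewrite -(mul0r `|v|); apply: cvgMr_tmp.
    by move=> m n nm; exact: dse.
  have [L LE] := linear_limit dcvg.
  have Ld n v : `|L v - 'd (s n) y v| <= e n * `|v|.
    rewrite LE; apply: (cvg_dist_le (n := n) (dcvg v)) => m nm.
    exact: dse.
  have cL : continuous L.
    have [k k0 kP] := linear_lipschitz (diff_continuous (ds 0%N y xy)).
    apply: (@linear_bound_continuous _ _ _ _ (e 0%N + k)) => v.
    rewrite -(subrK ('d (s 0%N) y v) (L v)) (le_trans (ler_normD _ _))//.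
    by rewrite mulrDl lerD.
  have lip n a b : ball x r a -> ball x r b ->
      `|(f b - s n b) - (f a - s n a)| <= e n * `|b - a|.
    move=> xa xb.
    rewrite -[X in `|X|]subr0.
    apply: (@cvg_dist_le (fun m => (s m b - s n b) - (s m a - s n a)) _ _ _ n).
      by apply: cvgB; (apply: cvgB; [exact: sf|exact: cvg_cst]).
    move=> m nm; rewrite subr0.
    apply: (@mean_value_ball _ _ (s m \- s n) x r (e n)) => //.
      by move=> z xz; apply: differentiableB; exact: ds.
    move=> z v xz.
    exact: dsB.
  suff [df dfL] : differentiable f y /\ 'd f y = L :> (E -> R^o).
    by split=> // v; rewrite dfL LE; exact: dcvg.
  apply: approx_diff => // d d0.
  have [n en] : exists n, e n <= d / 3 by apply: e_small; rewrite divr_gt0.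
  have d3 : 0 < d / 3 by rewrite divr_gt0.
  have near_ball : \forall h \near (0 : E), ball x r (y + h).
    have yh : y + h @[h --> (0 : E)] --> y + 0 by apply: cvgD; [exact: cvg_cst|].
    have : nbhs (y + 0) (ball x r).
      by rewrite addr0; apply: open_nbhs_nbhs; split => //; exact: ball_open.
    exact: yh.
  have := diff_approx (ds n y xy) d3.
  apply: filterS2 near_ball => h xyh.
  have := lip n y (y + h) xy xyh; rewrite [y + h]addrC addrK [h + y]addrC => + +.
  have := Ld n h.
  set A := _ - _; set B := _ - _; set D := _ - _ => HA HB HD.
  rewrite (_ : _ - _ = B + D - A); last by rewrite /A /B /D; ring.
  rewrite (le_trans (ler_normB _ _))//.
  have := ler_normD B D; have : e n * `|h| <= d / 3 * `|h| by rewrite ler_wpM2r.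
  lra.
split=> // d d0.
have d3 : 0 < d / 3 by rewrite divr_gt0.
have [n en] := e_small _ d3.
have close y v : ball x r y -> `|v| <= 1 -> `|'d f y v - 'd (s n) y v| <= d / 3.
  move=> xy v1; have [_ /(_ v) dcv] := main y xy.
  apply: (cvg_dist_le (n := n) dcv) => m nm.
  rewrite (le_trans (dse m n y v nm xy))// (le_trans (ler_wpM2r _ en))//.
  by rewrite ler_piMr// ltW.
have := cs n _ d3; apply: filterS2 (nbhsx_ballx x r r0) => y xy csy v v1.
have Hx := close x v (ballxx x r0) v1; rewrite distrC in Hx.
exact: dist_le_third (close y v xy v1) (csy v v1) Hx.
Qed.

End C1_limit.

(** * Functions of class C^1 on a manifold *)

Section charts.
Context {R : realType} {H : normedModType R} {M : topologicalType}.
Variable X : manifold H M.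
Implicit Types (i j : chart_index X) (p q : M) (y v : H).

Lemma chart_imgK i y : chart_img i y -> chart i (chart_inv i y) = y.
Proof. by case=> p ip <-; rewrite chartK// inE. Qed.

Lemma chart_inv_dom i y : chart_img i y -> chart_dom i (chart_inv i y).
Proof. by case=> p ip <-; rewrite chartK// inE. Qed.

Lemma chart_dom_img i p : chart_dom i p -> chart_img i (chart i p).
Proof. by exists p. Qed.

Lemma chart_cvg i p : chart_dom i p -> chart i @ p --> chart i p.
Proof.
move=> ip; have := @chart_continuous _ _ _ X i.
by rewrite (continuous_open_subspace _ (chart_dom_open i)); apply; rewrite inE.
Qed.

Lemma chart_inv_cvg i y : chart_img i y -> chart_inv i @ y --> chart_inv i y.
Proof.
move=> iy; have := @chart_inv_continuous _ _ _ X i.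
by rewrite (continuous_open_subspace _ (chart_img_open i)); apply; rewrite inE.
Qed.

Lemma chart_img_nbhs i y : chart_img i y -> nbhs y (chart_img i).
Proof. by move=> iy; apply: open_nbhs_nbhs; split => //; exact: chart_img_open. Qed.

Lemma chart_dom_nbhs i p : chart_dom i p -> nbhs p (chart_dom i).
Proof. by move=> ip; apply: open_nbhs_nbhs; split => //; exact: chart_dom_open. Qed.

Lemma chart_inv_near i j y : chart_img i y -> chart_dom j (chart_inv i y) ->
  \forall z \near y, chart_dom j (chart_inv i z).
Proof. by move=> iy jy; have /(_ _ (chart_dom_nbhs jy)) := chart_inv_cvg iy. Qed.

Lemma transition_diff i j y : chart_img i y -> chart_dom j (chart_inv i y) ->
  differentiable (chart j \o chart_inv i) y.
Proof.
move=> iy jy; have /Ck1P ij := @chart_transition _ _ _ X i j 1%N.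
have [] := ij y => //; exists (chart_inv i y); last exact: chart_imgK.
by split => //; exact: chart_inv_dom.
Qed.

(** The derivative of a function in the chart [i], computed from its expression
    in any other chart [j]: the chain rule for a change of charts. *)
Lemma chart_change {F : normedModType R} (f : M -> F) i j y :
  chart_img i y -> chart_dom j (chart_inv i y) ->
  differentiable (f \o chart_inv j) (chart j (chart_inv i y)) ->
  differentiable (f \o chart_inv i) y /\ forall v, 'd (f \o chart_inv i) y v =
    'd (f \o chart_inv j) (chart j (chart_inv i y)) ('d (chart j \o chart_inv i) y v).
Proof.
move=> iy jy df; have dt := transition_diff iy jy.
have dc : differentiable ((f \o chart_inv j) \o (chart j \o chart_inv i)) y.
  exact: differentiable_comp.
have E : \forall z \near y, ((f \o chart_inv j) \o (chart j \o chart_inv i)) z =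
    (f \o chart_inv i) z.
  by apply: filterS (chart_inv_near iy jy) => z jz /=; rewrite chartK// inE.
have [dfi ->] := diff_near_eq E dc; split=> // v.
by rewrite diff_comp.
Qed.

Lemma C1_diff f i y : C1_function X f -> chart_img i y ->
  differentiable (f \o chart_inv i : H -> R^o) y.
Proof. by move=> /(_ i)/Ck1P Cf iy; have [] := Cf y iy. Qed.

Lemma C1_continuous f : C1_function X f -> continuous f.
Proof.
move=> Cf p; have jp := chart_at_dom X p; set j := chart_at X p in jp.
have jy := chart_dom_img jp.
have := differentiable_continuous (C1_diff Cf jy).
rewrite /prop_for /continuous_at.
have -> : (f \o chart_inv j) (chart j p) = f p by rewrite /= chartK// inE.
move=> fc.
have : (f \o chart_inv j \o chart j) @ p --> f p.
  by apply: cvg_comp fc; exact: chart_cvg.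
apply: cvg_trans; apply: near_eq_cvg.
by apply: filterS (chart_dom_nbhs jp) => z jz /=; rewrite chartK// inE.
Qed.

Lemma C1_functionP f : C1_function X f <-> forall i y, chart_img i y ->
  differentiable (f \o chart_inv i : H -> R^o) y /\
  forall d : R, 0 < d -> \forall z \near y, forall v, `|v| <= 1 ->
    `|'d (f \o chart_inv i : H -> R^o) z v - 'd (f \o chart_inv i : H -> R^o) y v| <= d.
Proof. by split=> Cf i; [have /Ck1P := Cf i|apply/Ck1P; exact: Cf]. Qed.

Lemma differentialD f g p v : C1_function X f -> C1_function X g ->
  differential X (f \+ g) p v = differential X f p v + differential X g p v.
Proof.
move=> Cf Cg; rewrite /differential; set j := chart_at X p.
have jy := chart_dom_img (chart_at_dom X p); rewrite -/j in jy.
have df := C1_diff Cf jy; have dg := C1_diff Cg jy.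
have -> : (f \+ g) \o chart_inv j =
  (f \o chart_inv j : H -> R^o) + (g \o chart_inv j : H -> R^o) by [].
by rewrite diffD.
Qed.

Lemma differentialZ f p v (a : R) : C1_function X f ->
  differential X (a \*o f) p v = a * differential X f p v.
Proof.
move=> Cf; rewrite /differential; set j := chart_at X p.
have jy := chart_dom_img (chart_at_dom X p); rewrite -/j in jy.
have df := C1_diff Cf jy.
have -> : (a \*o f) \o chart_inv j = a *: (f \o chart_inv j : H -> R^o) by [].
by rewrite diffZ.
Qed.

Lemma C1_functionD f g : C1_function X f -> C1_function X g ->
  C1_function X (f \+ g).
Proof.
move=> Cf Cg; apply/C1_functionP => i y iy.
have df z (iz : chart_img i z) := C1_diff Cf iz.
have dg z (iz : chart_img i z) := C1_diff Cg iz.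
have -> : (f \+ g) \o chart_inv i =
  (f \o chart_inv i : H -> R^o) + (g \o chart_inv i : H -> R^o) by [].
split=> [|d d0]; first by apply: differentiableD; [exact: df|exact: dg].
have d2 : 0 < d / 2 by rewrite divr_gt0.
have [_ /(_ _ d2) cf] := (C1_functionP f).1 Cf i y iy.
have [_ /(_ _ d2) cg] := (C1_functionP g).1 Cg i y iy.
near=> z => v v1.
have iz : chart_img i z by near: z; exact: chart_img_nbhs.
rewrite (diffD (df z iz) (dg z iz)) (diffD (df y iy) (dg y iy)) /=.
rewrite opprD addrACA (splitr d) (le_trans (ler_normD _ _))// lerD//.
  exact: (near cf).
exact: (near cg).
Unshelve. all: by end_near. Qed.

Lemma C1_functionZ f (a : R) : C1_function X f -> C1_function X (a \*o f).
Proof.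
move=> Cf; apply/C1_functionP => i y iy.
have df z (iz : chart_img i z) := C1_diff Cf iz.
have -> : (a \*o f) \o chart_inv i = a *: (f \o chart_inv i : H -> R^o) by [].
split=> [|d d0]; first by apply: differentiableZ; exact: df.
have d2 : 0 < d / (`|a| + 1) by rewrite divr_gt0// ltr_wpDl.
have [_ /(_ _ d2) cf] := (C1_functionP f).1 Cf i y iy.
near=> z => v v1.
have iz : chart_img i z by near: z; exact: chart_img_nbhs.
rewrite (diffZ a (df z iz)) (diffZ a (df y iy)) /=.
rewrite -scalerBr normrZ.
have : `|'d (f \o chart_inv i : H -> R^o) z v - 'd (f \o chart_inv i : H -> R^o) y v| <=
  d / (`|a| + 1) by exact: (near cf).
rewrite ler_pdivlMr ?ltr_wpDl// mulrDr mulr1 mulrC; apply: le_trans.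
by rewrite mulrC lerDl.
Unshelve. all: by end_near. Qed.

Lemma C1_functionB f h : C1_function X f -> C1_function X h ->
  C1_function X (f \- h).
Proof.
move=> Cf Ch; have -> : f \- h = f \+ (-1 \*o h).
  by apply/funext => p /=; rewrite mulN1r.
exact: (C1_functionD Cf (C1_functionZ (-1) Ch)).
Qed.

End charts.

(** * Bounds on gradients *)

Section metric_bounds.
Context {R : realType} {H : normedModType R} {M : topologicalType}.
Variables (X : manifold H M) (g : riemannian_metric X).
Implicit Types (i j : chart_index X) (p q : M) (y v : H).

Lemma dot_ge0 (b : {dot H for idfun}) v : 0 <= b v v.
Proof.
by have [->|/neq0_dnorm_gt0/ltW//] := eqVneq v 0; rewrite linear0r.
Qed.

Lemma tnormZ p (a : R) v : tnorm g p (a *: v) = `|a| * tnorm g p v.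
Proof.
rewrite /tnorm linearZl_LR linearZr_LR /= mulrA -expr2.
by rewrite sqrtrM ?sqr_ge0// sqrtr_sqr.
Qed.

Lemma tnormN p v : tnorm g p (- v) = tnorm g p v.
Proof. by rewrite -scaleN1r tnormZ normrN1 mul1r. Qed.

Lemma tnorm_ge0 p v : 0 <= tnorm g p v.
Proof. exact: sqrtr_ge0. Qed.

Lemma tnorm_eq0 p v : tnorm g p v = 0 -> v = 0.
Proof.
move=> v0; have [C C0 /(_ v)/andP[+ _]] := metric_equiv g p.
rewrite -/(tnorm g p v) v0 => Cv; apply/eqP; rewrite -normr_le0.
by rewrite -(pmulr_rle0 _ (x := C^-1)) ?invr_gt0.
Qed.

Definition chart_norm i y v := tnorm g (chart_inv i y) (tangent_of_coord i y v).

Lemma chart_norm_metric i y v :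
  chart_norm i y v = Num.sqrt (local_metric g i y [:: v; v]).
Proof. by []. Qed.

Lemma chart_normZ i y (a : R) v : chart_norm i y (a *: v) = `|a| * chart_norm i y v.
Proof. by rewrite /chart_norm /tangent_of_coord linearZ tnormZ. Qed.

Lemma local_metric_near i y (e : R) : chart_img i y -> 0 < e ->
  \forall z \near y, forall v, `|v| <= 1 ->
    `|local_metric g i z [:: v; v] - local_metric g i y [:: v; v]| <= e.
Proof.
move=> iy e0; have [_ /(_ y iy e e0)] := metric_smooth g i 0%N.
apply: filterS => z zP v v1; apply: (zP [:: v; v]).
by split => //=; rewrite v1.
Qed.

(** A continuous family of bounded bilinear forms is locally bounded. *)
Lemma chart_norm_upper i y : chart_img i y ->
  exists2 C : R, 0 < C & \forall z \near y, forall v, chart_norm i z v <= C * `|v|.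
Proof.
move=> iy; have [/(_ y iy)[_ [C0 bC]] _] := metric_smooth g i 0%N.
exists (Num.sqrt (`|C0| + 1)); first by rewrite sqrtr_gt0 ltr_wpDl.
apply: filterS (local_metric_near iy ltr01) => z zP v.
have [->|v0] := eqVneq v 0.
  by rewrite -(scale0r 0) chart_normZ normr0 mul0r scale0r normr0 mulr0.
have nv0 : 0 < `|v| by rewrite normr_gt0.
have u1 : `|(`|v|^-1 *: v)| <= 1.
  by rewrite normrZ ger0_norm ?invr_ge0// mulVf// gt_eqF.
have : chart_norm i z (`|v|^-1 *: v) <= Num.sqrt (`|C0| + 1).
  rewrite chart_norm_metric; set u := _ *: v in u1 *.
  apply: ler_wsqrtr; have := zP _ u1; have : unit_args 2 [:: u; u].
    by split => //=; rewrite u1.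
  move=> /bC; rewrite !ler_norml => /andP[_ +] /andP[_ +].
  have := ler_norm C0; lra.
by rewrite chart_normZ ger0_norm ?invr_ge0// ler_pdivrMl// mulrC.
Qed.

Lemma tangent_of_coord_id p v :
  tangent_of_coord (chart_at X p) (chart (chart_at X p) p) v = v.
Proof.
have jp := chart_at_dom X p; rewrite /tangent_of_coord chartK ?inE//.
set j := chart_at X p in jp *; have jy := chart_dom_img jp.
have E : \forall z \near chart j p, id z = (chart j \o chart_inv j) z.
  by apply: filterS (chart_img_nbhs jy) => z jz /=; rewrite chart_imgK.
have di : is_diff (chart j p) id id := is_diff_id _.
by have [_ ->] := diff_near_eq E (@ex_diff _ _ _ _ _ _ _ di); rewrite diff_val.
Qed.

(** At the point [p] itself, the chart [chart_at X p] reads tangent vectors as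
    they are, so that the equivalence of [tnorm g p] with the Hilbert norm is
    the bound for [z] the image of [p]; continuity of the metric extends it to
    a neighbourhood. *)
Lemma chart_norm_lower p :
  exists2 C : R, 0 < C & \forall z \near chart (chart_at X p) p,
    forall v, `|v| <= C * chart_norm (chart_at X p) z v.
Proof.
set j := chart_at X p; have jp : chart_dom j p := chart_at_dom X p.
have jy := chart_dom_img jp; have [C0 C0p CP] := metric_equiv g p.
have e0 : 0 < C0^-1 ^+ 2 / 2 by rewrite divr_gt0// exprn_gt0// invr_gt0.
exists (Num.sqrt (C0^-1 ^+ 2 / 2))^-1; first by rewrite invr_gt0 sqrtr_gt0.
apply: filterS (local_metric_near jy e0) => z zP v.
have [->|v0] := eqVneq v 0.
  by rewrite -(scale0r 0) chart_normZ normr0 mul0r mulr0 scale0r normr0.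
have nv0 : 0 < `|v| by rewrite normr_gt0.
have u1 : `|(`|v|^-1 *: v)| = 1.
  by rewrite normrZ ger0_norm ?invr_ge0// mulVf// gt_eqF.
have : Num.sqrt (C0^-1 ^+ 2 / 2) <= chart_norm j z (`|v|^-1 *: v).
  rewrite chart_norm_metric; set u := _ *: v in u1 *.
  apply: ler_wsqrtr; have := zP u; rewrite u1 lexx => /(_ isT).
  rewrite /local_metric /= !tangent_of_coord_id chartK ?inE//.
  have /andP[+ _] := CP u; rewrite u1 mulr1 => Cu.
  have : C0^-1 ^+ 2 <= g p u u.
    rewrite -(@sqr_sqrtr _ (g p u u)) ?dot_ge0//.
    by rewrite ler_sqr ?nnegrE ?sqrtr_ge0// ltW// invr_gt0.
  rewrite ler_norml => + /andP[+ _]; lra.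
rewrite chart_normZ ger0_norm ?invr_ge0// ler_pdivlMl// => h.
by rewrite ler_pdivlMl ?sqrtr_gt0// mulrC.
Qed.

(** A bound on the norm of the differential, written vector by vector: in this
    form it is additive and passes to pointwise limits. *)
Definition gradient_le (f : M -> R) (m : R) :=
  forall p v, `|differential X f p v| <= m * tnorm g p v.

Lemma gradient_leP (f : M -> R) (m : R) : 0 <= m ->
  gradient_le f m <->
  (ereal_sup (range (differential_norm g f)) <= m%:E)%E.
Proof.
move=> m0; split=> [fm|fm].
  apply: ge_ereal_sup => _ [p _ <-]; apply: ge_ereal_sup => _ [v /= v1 <-].
  rewrite lee_fin (le_trans (ler_norm _))// (le_trans (fm p v))//.
  by rewrite ler_piMr.
have unit p v : tnorm g p v <= 1 -> differential X f p v <= m.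
  move=> v1; rewrite -lee_fin; apply: le_trans fm.
  apply: (@le_trans _ _ (differential_norm g f p)).
    by apply: ereal_sup_ubound; exists v.
  by apply: ereal_sup_ubound; exists p.
have pos p v : differential X f p v <= m * tnorm g p v.
  have [/tnorm_eq0 ->|v0] := eqVneq (tnorm g p v) 0.
    by rewrite /differential linear0 mulr_ge0// tnorm_ge0.
  have nv0 : 0 < tnorm g p v by rewrite lt_neqAle eq_sym v0 tnorm_ge0.
  have := unit p ((tnorm g p v)^-1 *: v).
  rewrite tnormZ ger0_norm ?invr_ge0 ?tnorm_ge0// mulVf// lexx => /(_ isT).
  by rewrite /differential linearZ /= ler_pdivrMl// mulrC.
move=> p v; rewrite ler_norml pos andbT lerNl.
by have := pos p (- v); rewrite tnormN /differential linearN.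
Qed.

Lemma gradient_leW f m m' : m <= m' -> gradient_le f m -> gradient_le f m'.
Proof.
by move=> mm' fm p v; rewrite (le_trans (fm p v))// ler_wpM2r// tnorm_ge0.
Qed.

Lemma gradient_leD f h m m' : C1_function X f -> C1_function X h ->
  gradient_le f m -> gradient_le h m' -> gradient_le (f \+ h) (m + m').
Proof.
move=> Cf Ch fm hm p v; rewrite differentialD// (le_trans (ler_normD _ _))//.
by rewrite mulrDl lerD.
Qed.

Lemma gradient_leZ f m a : C1_function X f ->
  gradient_le f m -> gradient_le (a \*o f) (`|a| * m).
Proof.
by move=> Cf fm p v; rewrite differentialZ// normrM -mulrA ler_wpM2l.
Qed.

Lemma gradient_le_chart f m i y v : C1_function X f -> gradient_le f m ->
  chart_img i y ->
  `|'d (f \o chart_inv i : H -> R^o) y v| <= m * chart_norm i y v.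
Proof.
move=> Cf fm iy; set q := chart_inv i y; set j := chart_at X q.
have jq : chart_dom j q := chart_at_dom X q.
have [_ ->] := chart_change (f := f : M -> R^o) iy jq (C1_diff Cf (chart_dom_img jq)).
exact: fm.
Qed.

(** The C^1 functions with the norm |f| + |df| are complete: in a chart, the
    Riemannian norm is locally bounded by the norm of the model space, so that
    the uniform limit theorem applies. *)
Lemma C1_function_limit (s : nat -> M -> R) (f : M -> R) (e : R^nat) :
  (forall n, C1_function X (s n)) ->
  (forall p, s n p @[n --> \oo] --> f p) ->
  (forall m n, (n <= m)%N -> gradient_le (s m \- s n) (e n)) ->
  (forall n, 0 <= e n) ->
  e @ \oo --> 0 ->
  C1_function X f /\
  forall p v, differential X (s n) p v @[n --> \oo] --> differential X f p v.
Proof.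
move=> Cs sf se eP e0.
have main i y : chart_img i y ->
    (differentiable (f \o chart_inv i : H -> R^o) y /\
     forall v, 'd (s n \o chart_inv i : H -> R^o) y v @[n --> \oo] -->
       'd (f \o chart_inv i : H -> R^o) y v) /\
    (forall d : R, 0 < d -> \forall z \near y, forall v, `|v| <= 1 ->
      `|'d (f \o chart_inv i : H -> R^o) z v - 'd (f \o chart_inv i : H -> R^o) y v| <= d).
  move=> iy; have [C C0 nC] := chart_norm_upper iy.
  have [r /= r0 ball_r] := (nbhs_ballP _ _).1 (filterI nC (chart_img_nbhs iy)).
  have ballN z : ball y r z -> forall v, chart_norm i z v <= C * `|v|.
    by move=> /ball_r[].
  have ball_img z : ball y r z -> chart_img i z by move=> /ball_r[].
  have [] := @C1_limit_ball _ _ (fun n => s n \o chart_inv i) (f \o chart_inv i)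
    y r (fun n => e n * C) r0.
  - by move=> n z /ball_img; exact: C1_diff.
  - by move=> n d d0; have [_ /(_ d d0)] := (C1_functionP X (s n)).1 (Cs n) i y iy.
  - by move=> z _; exact: sf.
  - move=> m n z v nm yz; have iz := ball_img z yz.
    have CB := C1_functionB (Cs m) (Cs n).
    have := gradient_le_chart v CB (se m n nm) iz.
    move=> /le_trans; apply.
    by rewrite -mulrA ler_wpM2l// ballN.
  - by rewrite -(mul0r C); exact: cvgMr_tmp.
  move=> /(_ y (ballxx _ r0)) ? ?; by split.
split.
  by apply/C1_functionP => i y /main[[df _] ?].
move=> p v; rewrite /differential.
by have [[_ +] _] := main _ _ (chart_dom_img (chart_at_dom X p)); apply.
Qed.

End metric_bounds.

(** * Integrals of nonnegative functions that need not be measurable *)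

Section lower_integral.
Local Open Scope ereal_scope.
Context d (T : measurableType d) (R : realType) (mu : {measure set T -> \bar R}).
Implicit Types (f h : T -> \bar R) (D : set T).

Import HBNNSimple.

(** The integral of a nonnegative function is a supremum over the simple
    functions below it. Monotonicity and superadditivity in the domain follow
    from that alone, without measurability of the integrand; the speed of a
    curve, which is read at each time in a chart that depends on the time, can
    then be integrated as it is. *)
Lemma le_lower_integral D1 D2 f h : D1 `<=` D2 ->
  (forall x, D1 x -> 0 <= f x) -> (forall x, D2 x -> 0 <= h x) ->
  (forall x, D1 x -> f x <= h x) ->
  \int[mu]_(x in D1) f x <= \int[mu]_(x in D2) h x.
Proof.
move=> D12 f0 h0 fh; rewrite !ge0_integralE//; apply: le_ereal_sup.
move=> _ [k /= kf <-]; exists k => //= x; apply: le_trans (kf x) _.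
rewrite /patch; case: ifPn => [/set_mem D1x|_].
  by rewrite mem_set ?fh//; exact: D12.
by case: ifPn => // /set_mem /h0.
Qed.

Lemma lower_integral_superadditive D1 D2 D f : [disjoint D1 & D2] ->
  D1 `<=` D -> D2 `<=` D -> (forall x, D x -> 0 <= f x) ->
  \int[mu]_(x in D1) f x + \int[mu]_(x in D2) f x <= \int[mu]_(x in D) f x.
Proof.
move=> D12 D1D D2D f0.
have f01 x : D1 x -> 0 <= f x by move=> /D1D/f0.
have f02 x : D2 x -> 0 <= f x by move=> /D2D/f0.
have [->|Iy] := eqVneq (\int[mu]_(x in D) f x) +oo; first by rewrite leey.
have I0 : 0 <= \int[mu]_(x in D) f x by exact: integral_ge0.
have I_fin : \int[mu]_(x in D) f x \is a fin_num by rewrite ge0_fin_numE// ltey.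
have sub x : D1 x -> ~ D2 x by move: D12 => /disj_setPS D12 ? ?; exact: (D12 x).
have step (k1 k2 : {nnsfun T >-> R}) : (forall x, (k1 x)%:E <= (f \_ D1) x) ->
    (forall x, (k2 x)%:E <= (f \_ D2) x) ->
    sintegral mu k1 + sintegral mu k2 <= \int[mu]_(x in D) f x.
  move=> k1f k2f; rewrite -(sintegralD mu k1 k2) [leRHS]ge0_integralE//.
  apply: ereal_sup_ubound; exists (add_nnsfun k1 k2) => //= x; rewrite EFinD.
  have := k1f x; have := k2f x; rewrite /patch.
  case: ifPn => [/set_mem D2x|_].
    rewrite memNset; last by move=> /sub.
    rewrite mem_set ?D2D//; last exact: D2D.
    by move=> h2 h1; rewrite -[leRHS]add0e leeD.
  case: ifPn => [/set_mem D1x|_].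
    rewrite mem_set; last exact: D1D.
    by move=> h2 h1; rewrite -[leRHS]adde0 leeD.
  move=> h2 h1; apply: (@le_trans _ _ 0); first by rewrite -[leRHS]adde0 leeD.
  by case: ifPn => // /set_mem/f0.
have le1 (k2 : {nnsfun T >-> R}) : (forall x, (k2 x)%:E <= (f \_ D2) x) ->
    \int[mu]_(x in D1) f x + sintegral mu k2 <= \int[mu]_(x in D) f x.
  move=> k2f.
  have k2_fin : sintegral mu k2 \is a fin_num.
    rewrite ge0_fin_numE ?sintegral_ge0//.
    apply: (@le_lt_trans _ _ (\int[mu]_(x in D) f x)); last by rewrite ltey.
    have := step nnsfun0 k2; rewrite sintegral0 add0e; apply => // x.
    by rewrite /patch; case: ifPn => // /set_mem/f01.
  rewrite -leeBrDr// [in leLHS]ge0_integralE//.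
  apply: ge_ereal_sup => _ [k1 /= k1f <-].
  by rewrite leeBrDr//; exact: step.
have I1_fin : \int[mu]_(x in D1) f x \is a fin_num.
  rewrite ge0_fin_numE ?integral_ge0//.
  apply: (@le_lt_trans _ _ (\int[mu]_(x in D) f x)); last by rewrite ltey.
  exact: le_lower_integral.
rewrite -leeBrDl// [in leLHS]ge0_integralE//.
apply: ge_ereal_sup => _ [k2 /= k2f <-].
by rewrite leeBrDl//; exact: le1.
Qed.

End lower_integral.

Section reflection.
Local Open Scope ereal_scope.
Context (R : realType).
Notation mu := (@lebesgue_measure R).

Import HBNNSimple.

Lemma lower_integral_opp (a b : R) (f : R -> \bar R) : (forall x, 0 <= f x) ->
  \int[mu]_(x in `[(- b)%R, (- a)%R]) f (- x)%R <= \int[mu]_(x in `[a, b]) f x.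
Proof.
move=> f0; rewrite [leLHS]ge0_integralE//; apply: ge_ereal_sup => _ [k /= kf <-].
rewrite -integralT_nnsfun.
have mopp : measurable_fun [set: measurableTypeR R]
    (-%R : measurableTypeR R -> measurableTypeR R) by exact: oppr_measurable.
have mk : measurable_fun [set: measurableTypeR R] (EFin \o k).
  exact/measurable_EFinP/measurable_funTS.
have -> : \int[mu]_x (k x)%:E = \int[mu]_x (k (- x)%R)%:E.
  transitivity (\int[pushforward mu (-%R : _ -> measurableTypeR R)]_x (k x)%:E).
    by apply: eq_measure_integral => A mA _; exact/esym/lebesgue_measureN.
  by rewrite ge0_integral_pushforward// => x _; rewrite lee_fin.
rewrite [leRHS]integral_mkcond.
apply: le_lower_integral => // x _; first by rewrite lee_fin.
  by rewrite /patch; case: ifPn.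
apply: le_trans (kf (- x)%R) _; rewrite /patch opprK.
by rewrite !mem_setE oppr_itvcc !opprK.
Qed.

End reflection.

(** * Symmetry of the Riemannian distance *)

Section reversal.
Context {R : realType} {H : normedModType R} {M : topologicalType}.
Variables (X : manifold H M) (g : riemannian_metric X).
Implicit Types (c : R -> M) (a b t : R).

Lemma is_diff_opp_comp {F : normedModType R} (f : R^o -> F) (t : R^o) :
  differentiable f (- t) ->
  differentiable (f \o -%R) t /\ forall h, 'd (f \o -%R) t h = 'd f (- t) (- h).
Proof.
move=> df; have dN : is_diff t (-%R : R^o -> R^o) (-%R : R^o -> R^o).
  exact: is_diffN.
have dNt := @ex_diff _ _ _ _ _ _ _ dN.
split=> [|h]; first exact: differentiable_comp.
have E : 'd (-%R : R^o -> R^o) t = -%R :> (R^o -> R^o) by exact: diff_val.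
transitivity ('d f (- t) ('d (-%R : R^o -> R^o) t h)).
  exact: (congr1 (fun u : R^o -> F => u h) (diff_comp dNt df)).
exact: (congr1 (fun u : R^o -> R^o => 'd f (- t) (u h)) E).
Qed.

Lemma eq_dist_le {F : normedModType R} (a b x y : F) (e : R) :
  a = x -> b = y -> `|x - y| <= e -> `|a - b| <= e.
Proof. by move=> -> ->. Qed.

Lemma near_opp (P : R^o -> Prop) (t : R^o) :
  (\forall s \near - t, P s) -> \forall s \near t, P (- s).
Proof. by move=> tP; exact: (@oppr_continuous _ R^o t _ tP). Qed.

Lemma C1_curveN c : C1_curve X c -> C1_curve X (c \o -%R).
Proof.
move=> [cc c1]; split.
  by move=> t; apply: continuous_comp; [exact: oppr_continuous|exact: cc].
move=> i; apply/Ck1P => t it.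
have [df cf] := (Ck1P _ _).1 (c1 i) (- t) it.
have [dfN dfNE] := is_diff_opp_comp df.
split; [exact: dfN|move=> e e0].
have open_i : open (c @^-1` chart_dom i : set R^o).
  by apply: open_comp => [? _|]; [exact: cc|exact: chart_dom_open].
have near_i : \forall s \near (- t : R^o), chart_dom i (c s).
  by apply: open_nbhs_nbhs; split.
have := near_opp (cf e e0); have := near_opp near_i.
apply: filterS2 => s si sP v v1.
have [dfs _] := (Ck1P _ _).1 (c1 i) (- s) si.
have [_ dfsE] := is_diff_opp_comp dfs.
apply: eq_dist_le (dfsE v) (dfNE v) (sP (- v) _).
by rewrite normrN.
Qed.

(** Piece [k] of the reversed curve is piece [size s - k.+1] of the curve. *)
Lemma piecewise_C1N c a b : piecewise_C1 X c a b ->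
  piecewise_C1 X (c \o -%R) (- b) (- a).
Proof.
case=> s abs pc.
exists (rev (belast (- a) (map -%R s))); first exact: itv_partition_rev.
rewrite size_rev size_belast size_map => k ks.
have lastb : last (- a) (map -%R s) = - b.
  by rewrite last_map; case: abs => _ /eqP ->.
have nthE m : (m <= size s)%N ->
    nth (- a) (- b :: rev (belast (- a) (map -%R s))) m =
    - nth b (a :: s) (size s - m).
  move=> ms; rewrite -lastb -rev_rcons -lastI nth_rev /= ?size_map//.
  rewrite -(map_cons -%R a s) subSS (nth_map b)//= ltnS leq_subr//.
have Ek : nth (- a) (rev (belast (- a) (map -%R s))) k =
    - nth b (a :: s) (size s - k.+1) by rewrite -(nthE k.+1).
rewrite (nthE k (ltnW ks)) Ek.
have j_lt : (size s - k.+1 < size s)%N by rewrite ltn_subrL (leq_trans _ ks).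
have [c' C1c' cc'] := pc _ j_lt.
exists (c' \o -%R); first exact: C1_curveN.
move=> t; rewrite -oppr_itvcc => tj /=; apply: cc'.
by move: tj; rewrite -[nth b s _]/(nth b (a :: s) (size s - k.+1).+1) -subSn.
Qed.

Lemma tnorm_velocityN c t :
  tnorm g ((c \o -%R) t) (velocity X (c \o -%R) t) =
  tnorm g (c (- t)) (velocity X c (- t)).
Proof.
have der (f : R^o -> H) (s : R) : derivable f (- s) 1 ->
    derivable (f \o -%R) s 1 /\ derive1 (f \o -%R) s = - derive1 f (- s).
  move=> /derivable1_diffP df; have [dN dNE] := is_diff_opp_comp df.
  split; first exact/derivable1_diffP.
  transitivity ('d (f \o -%R : R^o -> H) s 1).
    exact: etrans (derive1E _ _) (deriveE _ dN).
  transitivity ('d f (- s) (- 1)); first exact: dNE.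
  by rewrite linearN; congr (- _); exact/esym/(etrans (derive1E _ _) (deriveE _ df)).
rewrite /velocity /=; set f : R^o -> H := chart _ \o c.
rewrite -[X in derive1 X t]/(f \o -%R).
have [df|ndf] := pselect (derivable f (- t) 1).
  have [_ ->] := der f t df.
  by rewrite tnormN.
(* Where the curve has no velocity, neither has its reverse, and both limits
   of difference quotients are the default value [point]. *)
have ndfN : ~ derivable (f \o -%R) t 1.
  move=> dfN; apply: ndf; have [] := der (f \o -%R) (- t); first by rewrite opprK.
  have -> // : (f \o -%R) \o -%R = f by apply/funext => s /=; rewrite opprK.
congr tnorm; apply: (@etrans _ _ point).
  exact: etrans (derive1E _ _) (dvgP ndfN).
exact: etrans (esym (dvgP ndf)) (esym (derive1E _ _)).
Qed.

Lemma riemannian_dist_le_sym (p q : M) :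
  (riemannian_dist g q p <= riemannian_dist g p q)%E.
Proof.
apply: le_ereal_inf_tmp => _ [c [a [b [ab pc <- <- ->]]]].
apply: (@le_trans _ _ (curve_length g (c \o -%R) (- b) (- a))).
  apply: ereal_inf_lbound; exists (c \o -%R), (- b), (- a).
  split; [by rewrite lerN2|exact: piecewise_C1N| | |by []] => /=;
  by rewrite opprK.
rewrite /curve_length; under eq_integral do rewrite tnorm_velocityN.
apply: (lower_integral_opp a b (f := fun t => (tnorm g (c t) (velocity X c t))%:E)).
by move=> t; rewrite lee_fin tnorm_ge0.
Qed.

Lemma riemannian_distC (p q : M) : riemannian_dist g p q = riemannian_dist g q p.
Proof. by apply/eqP; rewrite eq_le !riemannian_dist_le_sym. Qed.

Lemma riemannian_dist_ge0 (p q : M) : (0 <= riemannian_dist g p q)%E.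
Proof.
apply: le_ereal_inf_tmp => _ [c [a [b [_ _ _ _ ->]]]].
by apply: integral_ge0 => t _; rewrite lee_fin tnorm_ge0.
Qed.

End reversal.

(** * The Riemannian distance and the topology of the manifold *)

Section displacement.
Context {R : realType} {H : normedModType R}.
Variables (ip : {dot H for idfun}) (ip_norm : induces_norm ip).
Notation mu := (@lebesgue_measure R).

(** The Cauchy-Schwarz inequality, from the triangle inequality for the norm of
    [x + y]. *)
Lemma ip_le (u v : H) : `|ip u v| <= `|u| * `|v|.
Proof.
have le_ip (x y : H) : ip x y <= `|x| * `|y|.
  have : `|x + y| ^+ 2 <= (`|x| + `|y|) ^+ 2.
    by rewrite ler_sqr ?nnegrE ?addr_ge0// ler_normD.
  rewrite -ip_norm linearDl !linearDr /= (hermC ip y x) expr0 mul1r /=.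
  rewrite !ip_norm sqrrD; lra.
rewrite ler_norml le_ip andbT lerNl.
by have := le_ip (- u) v; rewrite linearNl normrN.
Qed.

Lemma ip_linear_continuous (w : H) :
  exists2 L : {linear H -> R^o}, continuous L & forall u, L u = ip u w.
Proof.
have Llin : linear (fun u => ip u w : R^o) by move=> a u v; rewrite linearPl.
pose L := HB.pack_for {linear H -> R^o} (fun u => ip u w : R^o)
  (GRing.isLinear.Build _ _ _ _ _ Llin).
exists L => //; apply: (@linear_bound_continuous _ _ _ L `|w|) => v.
by rewrite mulrC; exact: ip_le.
Qed.

(** The fundamental theorem of calculus is applied to a real function only: the
    inner product of the curve with its displacement vector. *)
Lemma displacement_le (c : R^o -> H) (a b : R) : a < b ->
  (forall t, a <= t <= b -> differentiable c t) ->
  (forall t, a <= t <= b -> {for t, continuous (fun s : R^o => 'd c s 1)}) ->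
  (`|c b - c a|%:E <= \int[mu]_(t in `]a, b[) `|'d c t 1|%:E)%E.
Proof.
move=> ab dc cdc; set w := c b - c a.
have [w0|w0] := eqVneq w 0.
  by rewrite w0 normr0 integral_ge0// => t _; rewrite lee_fin.
have [L cL LE] := ip_linear_continuous w.
pose h : R -> R := L \o c; pose h' (t : R) : R := L ('d c t 1).
have dh (t : R) : a <= t <= b -> is_derive (t : R^o) (1 : R^o) (h : R^o -> R^o) (h' t).
  move=> tab; have dct := dc t tab.
  have dL : differentiable (L : H -> R^o) (c t) by exact: linear_differentiable.
  have dLc : differentiable (L \o c) (t : R^o) by exact: differentiable_comp.
  apply: DeriveDef; first exact: diff_derivable.
  transitivity ('d (L \o c) (t : R^o) 1); first exact: deriveE.
  transitivity ('d (L : H -> R^o) (c t) ('d c t 1)).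
    exact: (congr1 (fun u : R^o -> R^o => u 1) (diff_comp dct dL)).
  exact: (congr1 (fun u : H -> R^o => u ('d c t 1)) (diff_lin (c t) cL)).
have ch' (t : R) : a <= t <= b -> {for t, continuous h'}.
  by move=> tab; apply: continuous_comp; [exact: cdc|exact: cL].
have cspeed (t : R) : a <= t <= b -> {for t, continuous (fun s : R => `|'d c s 1|)}.
  by move=> tab; apply: cvg_norm; exact: cdc.
have in_itvE (t : R) : t \in `[a, b]%classic = (a <= t <= b).
  by rewrite mem_setE in_itv.
have mfun (f : R -> R) : (forall t, a <= t <= b -> {for t, continuous f}) ->
    measurable_fun `[a, b] f.
  move=> cf; apply: subspace_continuous_measurable_fun => //.
  by apply: continuous_in_subspaceT => t; rewrite in_itvE; exact: cf.
have ftc : (\int[mu]_(t in `[a, b]) (h' t)%:E = (h b)%:E - (h a)%:E)%E.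
  apply: continuous_FTC2 => //.
  - by apply: continuous_in_subspaceT => t; rewrite in_itvE; exact: ch'.
  - have ch (t : R) : a <= t <= b -> {for t, continuous h}.
      move=> /dh[+ _]; move/derivable1_diffP; exact: differentiable_continuous.
    split.
    + by move=> t; rewrite in_itv/= => /andP[a_t tb]; have [] := dh t; rewrite ?ltW.
    + by apply: cvg_at_right_filter; apply: ch; rewrite lexx ltW.
    + by apply: cvg_at_left_filter; apply: ch; rewrite lexx ltW.
  - move=> t; rewrite in_itv/= => /andP[a_t tb].
    by rewrite derive1E; have [] := dh t; rewrite ?ltW.
have hw : h b - h a = `|w| ^+ 2.
  by rewrite -ip_norm -{1}/(c b - c a) linearBl /h /= !LE.
have w_le : ((`|w| ^+ 2)%:E <= `|w|%:E * \int[mu]_(t in `[a, b]) `|'d c t 1|%:E)%E.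
  rewrite -hw EFinB -ftc; apply: le_trans (lee_abs _) _.
  apply: le_trans (le_abse_integral _ _ _) _ => //.
    by apply/measurable_EFinP; exact: mfun.
  rewrite -ge0_integralZl//; last by apply/measurable_EFinP; exact: mfun.
  apply: ge0_le_integral => //.
  - by apply/measurable_EFinP; apply: measurableT_comp => //; exact: mfun.
  - by apply: measurable_funeM; apply/measurable_EFinP; exact: mfun.
  - move=> t _; rewrite -EFinM lee_fin /h' LE mulrC; exact: ip_le.
have open_close : (\int[mu]_(t in `[a, b]) `|'d c t 1|%:E =
    \int[mu]_(t in `]a, b[) `|'d c t 1|%:E)%E.
  apply: integral_itv_bndoo; apply/measurable_EFinP.
  by apply: measurable_funS (mfun _ cspeed) => //; exact: subset_itv_oo_cc.
have nw0 : 0 < `|w| by rewrite normr_gt0.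
by move: w_le; rewrite expr2 EFinM open_close lee_pmul2l// lte_fin.
Qed.

End displacement.

Section exit.
Context {R : realType} {H : completeNormedModType R} {M : topologicalType}.
Variables (ip : {dot H for idfun}) (ip_norm : induces_norm ip).
Variables (X : manifold H M) (g : riemannian_metric X).
Notation mu := (@lebesgue_measure R).
Implicit Types (i j : chart_index X) (p q : M) (c : R -> M).

Definition speed c (t : R) : R := tnorm g (c t) (velocity X c t).

Lemma speed_ge0 c t : 0 <= speed c t.
Proof. exact: tnorm_ge0. Qed.

Lemma curve_chart_diff c i t : C1_curve X c -> chart_dom i (c t) ->
  differentiable (chart i \o c : R^o -> H) t /\
  {for t, continuous (fun s : R^o => 'd (chart i \o c : R^o -> H) s 1)}.
Proof.
move=> [_ c1] it; have [df cf] := (Ck1P _ _).1 (c1 i) t it; split=> //.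
apply/cvgrPdist_le => e e0; have := cf e e0; apply: filterS => s sP.
by rewrite distrC; apply: sP; rewrite normr1.
Qed.

(** The velocity is read in the chart selected at each time, so that its
    coordinates jump with the selection; its norm can be computed in any fixed
    chart. *)
Lemma speed_chart c i t : C1_curve X c -> chart_dom i (c t) ->
  speed c t = chart_norm g i (chart i (c t)) ('d (chart i \o c : R^o -> H) t 1).
Proof.
move=> Cc it; have [dg _] := curve_chart_diff Cc it.
have iy := chart_dom_img it.
have EK : chart_inv i (chart i (c t)) = c t by rewrite chartK// inE.
rewrite /speed /chart_norm /tangent_of_coord EK; congr tnorm.
rewrite /velocity; set j := chart_at X (c t).
have jt : chart_dom j (chart_inv i (chart i (c t))).
  by rewrite EK; exact: chart_at_dom.
have dt := transition_diff iy jt.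
have dc : differentiable ((chart j \o chart_inv i) \o (chart i \o c) : R^o -> H) t.
  exact: differentiable_comp.
have near_i : \forall s \near (t : R^o), chart_dom i (c s).
  by have [cc _] := Cc; exact: (cc t _ (chart_dom_nbhs it)).
have E : \forall s \near (t : R^o),
    ((chart j \o chart_inv i) \o (chart i \o c)) s = (chart j \o c) s.
  by apply: filterS near_i => s si /=; rewrite chartK// inE.
have [dj djE] := diff_near_eq E dc.
apply: (etrans (derive1E _ _)); apply: (etrans (deriveE _ dj)).
apply: (etrans (congr1 (fun u : R^o -> H => u 1) djE)).
exact: (congr1 (fun u : R^o -> H => u 1) (diff_comp dg dt)).
Qed.

(** On the ball of centre [y0] and radius [r], the metric read in the chart [i]
    dominates the norm up to the factor [C]; as long as a curve stays over this
    ball, [C] times its length dominates its displacement in the chart. *)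
Variables (i : chart_index X) (y0 : H) (r C : R) (C_gt0 : 0 < C).
Hypothesis ball_img : ball y0 r `<=` chart_img i.
Hypothesis ball_norm :
  forall y, ball y0 r y -> forall v, `|v| <= C * chart_norm g i y v.

Definition chart_ball : set M := [set q | chart_dom i q /\ ball y0 r (chart i q)].

Lemma chart_ball_nbhs q : chart_ball q -> nbhs q chart_ball.
Proof.
move=> [iq bq]; apply: filterI; first exact: chart_dom_nbhs.
by apply: (chart_cvg iq); apply: open_nbhs_nbhs; split => //; exact: ball_open.
Qed.

Lemma chart_displacement_le c a b : C1_curve X c -> a <= b ->
  (forall t, a <= t <= b -> chart_ball (c t)) ->
  (`|chart i (c b) - chart i (c a)|%:E <=
    C%:E * \int[mu]_(t in `]a, b[) (speed c t)%:E)%E.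
Proof.
move=> Cc; rewrite le_eqVlt => /predU1P[<- _|ab ball_c].
  rewrite subrr normr0 mule_ge0//; first by rewrite lee_fin ltW.
  by apply: integral_ge0 => t _; rewrite lee_fin speed_ge0.
have dcc t (tab : a <= t <= b) := curve_chart_diff Cc (proj1 (ball_c t tab)).
have := displacement_le ip_norm ab (fun t tab => proj1 (dcc t tab))
  (fun t tab => proj2 (dcc t tab)).
move=> /le_trans; apply.
have mf : measurable_fun `]a, b[
    (fun t : R => `|'d (chart i \o c : R^o -> H) t 1|).
  apply: open_continuous_measurable_fun => //.
  move=> t; rewrite mem_setE in_itv/= => /andP[a_t tb].
  by apply: cvg_norm; have [|_] := dcc t; [rewrite !ltW|exact].
rewrite -lee_pdivrMl//.
rewrite -ge0_integralZl//; first last.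
- by rewrite lee_fin invr_ge0 ltW.
- exact/measurable_EFinP.
apply: le_lower_integral => // t; rewrite /= ?in_itv/=.
- by move=> _; rewrite -EFinM lee_fin mulr_ge0// invr_ge0 ltW.
- by move=> _; rewrite lee_fin speed_ge0.
- move=> /andP[a_t tb]; have [|it bt] := ball_c t; first by rewrite !ltW.
  rewrite -EFinM lee_fin ler_pdivrMl// (speed_chart Cc it).
  exact: ball_norm.
Qed.

(** The set [chart_ball] is open in a manifold that might not be regular, so
    that a curve could a priori leave it at a point that is not on its
    boundary sphere in the chart. A curve that is Cauchy in the chart cannot:
    its coordinates converge, and limits are unique. *)
Lemma chart_ball_closed_under_limits (F : set_system R) (FF : ProperFilter F) c q
    (rho : R) : rho < r ->
  (forall e : R, 0 < e -> exists y, F [set t | ball y e (chart i (c t))]) ->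
  F [set t | chart_ball (c t) /\ `|chart i (c t) - y0| <= rho] ->
  c @ F --> q -> chart_ball q.
Proof.
move=> rho_r cauchy_c F_c cq.
have [w cw] : exists w : H, (chart i \o c) @ F --> w.
  exists (lim ((chart i \o c) @ F)); apply: (@cauchy_cvg H).
  apply: cauchy_exP => e e0.
  by have [y Fy] := cauchy_c e e0; exists y.
have yw : `|w - y0| <= rho.
  have nw : `|(chart i \o c) t - y0| @[t --> F] --> `|w - y0|.
    by apply: cvg_norm; apply: cvgB => //; exact: cvg_cst.
  apply: (@closed_cvg _ _ F _ _ [set s | s <= rho] _ _ _ nw).
    exact: closed_le.
  by apply: filterS F_c => t [].
have bw : ball y0 r w.
  by rewrite -ball_normE /= distrC (le_lt_trans yw).
have iw := ball_img bw.
have cq' : c @ F --> chart_inv i w.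
  have : (chart_inv i \o (chart i \o c)) @ F --> chart_inv i w.
    by apply: cvg_comp cw _; exact: chart_inv_cvg.
  apply: cvg_trans; apply: near_eq_cvg.
  by apply: filterS F_c => t [[it _] _] /=; rewrite chartK// inE.
have -> : q = chart_inv i w.
  exact: (cvg_unique (@manifold_hausdorff _ _ _ X) cq cq').
split; first exact: chart_inv_dom.
by rewrite chart_imgK.
Qed.

(** A curve that is too short to reach the boundary of the ball stays over it.
    Let ]t0, z] be the largest interval ending at [z] over which it stays. There
    the chart image is Cauchy at [t0], because its displacements are dominated
    by increments of a bounded monotone function, the length, and the limit is
    the point of time [t0]. Closed balls of the model space need not be compact,
    so that completeness takes the place of compactness. *)
Lemma short_curve_stays c a z (L : R) : C1_curve X c -> a <= z ->
  chart_ball (c z) ->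
  (\int[mu]_(t in `]a, z[) (speed c t)%:E <= L%:E)%E ->
  `|chart i (c z) - y0| + C * L < r ->
  chart_ball (c a) /\
  (`|chart i (c z) - chart i (c a)|%:E <=
    C%:E * \int[mu]_(t in `]a, z[) (speed c t)%:E)%E.
Proof.
move=> Cc az cz lenL rL.
pose S := [set t | a <= t <= z /\ forall s, t <= s <= z -> chart_ball (c s)].
have Sz : S z.
  split; first by rewrite az lexx.
  by move=> s /andP[zs sz]; have -> : s = z by apply/eqP; rewrite eq_le sz zs.
suff Sa : S a.
  split; first by apply: (proj2 Sa); rewrite lexx az.
  by apply: chart_displacement_le => //; exact: (proj2 Sa).
have S_lb : has_lbound S by exists a => t [/andP[]].
have S_inf : has_inf S by split; first by exists z.
pose t0 := inf S.
have a_t0 : a <= t0 by apply: lb_le_inf; [exists z|move=> t [/andP[]]].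
have t0_z : t0 <= z by exact: ge_inf.
have S_right t : t0 < t <= z -> S t.
  move=> /andP[t0t tz].
  have [u Su ut] : exists2 u, S u & u < t.
    have [u Su] := @inf_adherent _ S (t - t0) (ltac:(by rewrite subr_gt0)) S_inf.
    by rewrite -/t0 addrC subrK => ut; exists u.
  split; first by rewrite tz andbT (le_trans a_t0)// ltW.
  move=> s /andP[ts sz]; apply: (proj2 Su); rewrite sz andbT.
  by rewrite (le_trans (ltW ut)).
pose len t := (\int[mu]_(s in `]t, z[) (speed c s)%:E)%E.
have speed0 (D : set R) t : D t -> (0 <= (speed c t)%:E)%E.
  by move=> _; rewrite lee_fin speed_ge0.
have len0 t : (0 <= len t)%E by apply: integral_ge0 => s; exact: speed0.
have lenL' t : a <= t -> (len t <= L%:E)%E.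
  move=> a_t; apply: le_trans lenL; apply: le_lower_integral => //.
  - by move=> s /=; rewrite !in_itv/= => /andP[ts ->]; rewrite (le_lt_trans a_t).
  - by move=> s; exact: speed0.
  - by move=> s; exact: speed0.
have len_fin t : a <= t -> len t \is a fin_num.
  by move=> a_t; rewrite ge0_fin_numE// (le_lt_trans (lenL' t a_t))// ltey.
have disp t u : S t -> t <= u <= z ->
    `|chart i (c u) - chart i (c t)| <= C * (fine (len t) - fine (len u)).
  move=> [/andP[a_t tz] St] /andP[tu uz].
  have a_u : a <= u by exact: le_trans tu.
  rewrite -lee_fin; apply: le_trans (chart_displacement_le Cc tu _) _.
    by move=> s /andP[ts su]; apply: St; rewrite ts (le_trans su).
  rewrite EFinM lee_pmul2l ?lte_fin// EFinB !fineK ?len_fin//.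
  rewrite leeBrDr ?len_fin//; apply: lower_integral_superadditive.
  - apply/disj_setPS => s /= []; rewrite !in_itv/= => /andP[_ su] /andP[us _].
    by have := lt_trans su us; rewrite ltxx.
  - by move=> s /=; rewrite !in_itv/= => /andP[-> su]; rewrite (lt_le_trans su).
  - by move=> s /=; rewrite !in_itv/= => /andP[us ->]; rewrite (le_lt_trans tu).
  - by move=> s; exact: speed0.
have St0 : S t0.
  move: t0_z; rewrite le_eqVlt => /predU1P[->//|t0_z].
  split; first by rewrite a_t0 ltW.
  suff ball_t0 : chart_ball (c t0).
    move=> s /andP[]; rewrite le_eqVlt => /predU1P[<-//|t0s] sz.
    by have [_] := S_right s (ltac:(by rewrite t0s)); apply; rewrite lexx.
  apply: (@chart_ball_closed_under_limits (t0^'+) _ c _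
    (`|chart i (c z) - y0| + C * L)) => //.
  - move=> e e0.
    pose J := [set fine (len t) | t in [set t | t0 < t <= z]].
    have J_sup : has_sup J.
      split; first by exists (fine (len z)), z => //=; rewrite t0_z lexx.
      exists L => _ [t /= /andP[t0t _] <-].
      have a_t : a <= t by rewrite (le_trans a_t0)// ltW.
      by rewrite -lee_fin fineK ?len_fin// lenL'.
    have eC : 0 < e / C by rewrite divr_gt0.
    have [_ [u /= /andP[t0u uz] <-] Ju] := sup_adherent eC J_sup.
    exists (chart i (c u)); near=> t.
    have t0t : t0 < t by near: t; exact: nbhs_right_gt.
    have tu : t < u by near: t; exact: nbhs_right_lt.
    have tz : t <= z by rewrite (le_trans (ltW tu)).
    rewrite -ball_normE /=; apply: le_lt_trans (disp t u _ _) _.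
    + by apply: S_right; rewrite t0t.
    + by rewrite (ltW tu).
    + have : fine (len t) <= sup J.
        by apply: sup_upper_bound => //; exists t => //=; rewrite t0t.
      rewrite mulrC -ltr_pdivlMr//; lra.
  - near=> t.
    have t0t : t0 < t by near: t; exact: nbhs_right_gt.
    have tz : t <= z by near: t; exact: nbhs_right_ltW.
    have St := S_right t (ltac:(by rewrite t0t)).
    split; first by apply: (proj2 St); rewrite lexx.
    have := disp t z St (ltac:(by rewrite tz lexx)).
    have := ler_distD (chart i (c z)) (chart i (c t)) y0.
    rewrite (distrC (chart i (c t)) (chart i (c z))).
    have a_t : a <= t by rewrite (le_trans a_t0)// ltW.
    have : C * (fine (len t) - fine (len z)) <= C * L.
      rewrite ler_pM2l// lerBlDr -[leLHS]addr0 lerD ?fine_ge0//.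
      by rewrite -lee_fin fineK ?len_fin// lenL'.
    lra.
  - by apply: cvg_at_right_filter; exact: (proj1 Cc).
move: a_t0; rewrite le_eqVlt => /predU1P[->//|a_t0].
have near_t0 : \forall s \near t0, chart_ball (c s).
  apply: (proj1 Cc t0); apply: chart_ball_nbhs.
  by apply: (proj2 St0); rewrite lexx t0_z.
have [d /= d0 dball] := (nbhs_ballP _ _).1 near_t0.
pose t1 := Num.max a (t0 - d / 2).
have t1_t0 : t1 < t0 by rewrite gt_max a_t0 ltrBlDr ltrDl divr_gt0.
suff : S t1 by move=> /(ge_inf S_lb); rewrite -/t0 leNgt t1_t0.
split; first by rewrite le_max lexx /= (le_trans (ltW t1_t0)).
move=> s /andP[t1s sz]; have [t0s|st0] := leP t0 s.
  by apply: (proj2 St0); rewrite t0s.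
apply: dball; rewrite -ball_normE /= ger0_norm ?subr_ge0 ?ltW//.
move: t1s; rewrite ge_max => /andP[_ t1s].
by lra.
Unshelve. all: by end_near. Qed.

End exit.

Section riemannian_topology.
Context {R : realType} {H : completeNormedModType R} {M : topologicalType}.
Variables (ip : {dot H for idfun}) (ip_norm : induces_norm ip).
Variables (X : manifold H M) (g : riemannian_metric X).
Notation mu := (@lebesgue_measure R).
Implicit Types (p q : M) (c : R -> M).

Lemma eq_speed c c' t : (\forall s \near t, c s = c' s) -> speed g c t = speed g c' t.
Proof.
move=> cc'; rewrite /speed /velocity (nbhs_singleton cc'); congr tnorm.
rewrite !derive1E; apply: near_eq_derive.
by apply: filterS cc' => s /= ->.
Qed.

(** Induction on the pieces, from the end point [p] backwards: the distance to
    the centre is bounded by the length of the part of the curve that remains. *)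
Lemma short_piecewise_stays (i : chart_index X) (p : M) (r C : R) : 0 < C ->
  ball (chart i p) r `<=` chart_img i ->
  (forall y, ball (chart i p) r y -> forall v, `|v| <= C * chart_norm g i y v) ->
  chart_dom i p -> 0 < r ->
  forall c a b (L : R), piecewise_C1 X c a b -> c b = p ->
  (\int[mu]_(t in `]a, b[) (speed g c t)%:E <= L%:E)%E -> C * L < r ->
  chart_ball i (chart i p) r (c a).
Proof.
move=> C0 ball_img ball_norm ip0 r0 c a b L [s].
set V := chart_ball _ _ _.
have sp0 (D : set R) t : D t -> (0 <= (speed g c t)%:E)%E.
  by move=> _; rewrite lee_fin speed_ge0.
move=> abs pieces cb lenL CL.
suff [] : V (c a) /\ (`|chart i (c a) - chart i p|%:E <=
    C%:E * \int[mu]_(t in `]a, b[) (speed g c t)%:E)%E by [].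
elim: s a abs pieces lenL => [|x s IH] a.
  move=> /itv_partition_nil -> _ _; rewrite cb subrr normr0; split.
    by split => //; exact: ballxx.
  apply: mule_ge0; first by rewrite lee_fin ltW.
  by apply: integral_ge0 => t; exact: sp0.
move=> abs pieces lenL; have xb := itv_partition_cons abs.
have ax : a < x by case: abs => /= /andP[].
have x_b : x <= b := itv_partition_le xb.
have sub_len : (\int[mu]_(t in `]a, x[) (speed g c t)%:E +
    \int[mu]_(t in `]x, b[) (speed g c t)%:E <=
    \int[mu]_(t in `]a, b[) (speed g c t)%:E)%E.
  apply: lower_integral_superadditive.
  - apply/disj_setPS => t /= []; rewrite !in_itv/= => /andP[_ tx] /andP[xt _].
    by have := lt_trans tx xt; rewrite ltxx.
  - by move=> t /=; rewrite !in_itv/= => /andP[-> tx]; rewrite (lt_le_trans tx).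
  - by move=> t /=; rewrite !in_itv/= => /andP[xt ->]; rewrite (lt_trans ax).
  - by move=> t; exact: sp0.
set Iax := (\int[mu]_(t in `]a, x[) _)%E in sub_len.
set Ixb := (\int[mu]_(t in `]x, b[) _)%E in sub_len.
have Iax0 : (0 <= Iax)%E by apply: integral_ge0 => t; exact: sp0.
have Ixb0 : (0 <= Ixb)%E by apply: integral_ge0 => t; exact: sp0.
have sumL : (Iax + Ixb <= L%:E)%E by exact: le_trans lenL.
have Iax_fin : Iax \is a fin_num.
  rewrite ge0_fin_numE//; apply: (@le_lt_trans _ _ L%:E); last by rewrite ltey.
  by apply: le_trans sumL; rewrite leeDl.
have Ixb_fin : Ixb \is a fin_num.
  rewrite ge0_fin_numE//; apply: (@le_lt_trans _ _ L%:E); last by rewrite ltey.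
  by apply: le_trans sumL; rewrite leeDr.
have [] := IH x xb.
- by move=> k ks; exact: (pieces k.+1).
- by apply: le_trans sumL; rewrite leeDr.
rewrite -/Ixb => Vx dx.
have [c' Cc' cc'] := pieces 0%N isT.
have {}cc' t : a <= t <= x -> c t = c' t.
  by move=> tax; apply: cc'; rewrite in_itv.
have Iax' : (\int[mu]_(t in `]a, x[) (speed g c' t)%:E)%E = Iax.
  apply: eq_integral => t; rewrite mem_setE in_itv/= => /andP[a_t tx].
  congr EFin; apply/esym/eq_speed; near=> u; apply: cc'.
  apply/andP; split; apply: ltW.
    by near: u; exact: lt_nbhsr.
  by near: u; exact: lt_nbhsl.
have cx : c x = c' x by apply: cc'; rewrite lexx ltW.
have ca : c a = c' a by apply: cc'; rewrite lexx ltW.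
move: dx; rewrite -(fineK Ixb_fin) -EFinM lee_fin => dx.
have fin_sumL : fine Iax + fine Ixb <= L by rewrite -lee_fin EFinD !fineK.
have [] := @short_curve_stays _ _ _ _ ip_norm X g i (chart i p) r C C0 ball_img
  ball_norm c' a x (fine Iax) Cc' (ltW ax).
- by rewrite -cx.
- by rewrite Iax' fineK.
- rewrite -cx; apply: le_lt_trans CL.
  have : C * (fine Iax + fine Ixb) <= C * L by rewrite ler_pM2l.
  by rewrite mulrDr; lra.
rewrite -ca -cx Iax' => Va.
rewrite -(fineK Iax_fin) -EFinM lee_fin => da; split; first exact: Va.
apply: (@le_trans _ _ (C%:E * (Iax + Ixb))%E); last by rewrite lee_pmul2l ?lte_fin.
rewrite -(fineK Iax_fin) -(fineK Ixb_fin) -EFinD -EFinM lee_fin mulrDr.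
have := ler_distD (chart i (c x)) (chart i (c a)) (chart i p).
by rewrite (distrC (chart i (c a)) (chart i (c x))); lra.
Unshelve. all: by end_near. Qed.

(** The topology of the Riemannian distance is finer than the topology of the
    manifold: a short curve ending at [p] cannot leave a ball of a chart on
    which the metric is bounded below. *)
Lemma riemannian_dist_nbhs p (U : set M) : nbhs p U ->
  exists2 e : R, 0 < e & forall q, (riemannian_dist g q p < e%:E)%E -> U q.
Proof.
move=> pU; set i := chart_at X p; have ip0 : chart_dom i p := chart_at_dom X p.
have iy := chart_dom_img ip0.
have [C C0 nC] := chart_norm_lower g p; rewrite -/i in nC.
have nU : \forall y \near chart i p, U (chart_inv i y).
  by apply: (chart_inv_cvg iy); rewrite chartK// inE.
have [r /= r0 ball_r] := (nbhs_ballP _ _).1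
  (filterI nU (filterI nC (chart_img_nbhs iy))).
exists (r / C); first by rewrite divr_gt0.
move=> q /ereal_inf_lt[_ [c [a [b [ab pc ca cb ->]]]] len_lt].
have len0 : (0 <= curve_length g c a b)%E.
  by apply: integral_ge0 => t _; rewrite lee_fin tnorm_ge0.
have len_fin : curve_length g c a b \is a fin_num.
  by rewrite ge0_fin_numE// (lt_trans len_lt)// ltey.
have [] := @short_piecewise_stays i p r C C0 _ _ ip0 r0 c a b
  (fine (curve_length g c a b)) pc cb.
- by move=> y /ball_r[_ []].
- by move=> y /ball_r[_ []].
- rewrite fineK//; apply: le_lower_integral => [t|t _|t _|//].
  + by move=> /=; rewrite !in_itv/= => /andP[/ltW-> /ltW].
  + by rewrite lee_fin tnorm_ge0.
  + by rewrite lee_fin tnorm_ge0.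
- by rewrite mulrC -ltr_pdivlMr// -lte_fin fineK.
by move=> ia /ball_r[]; rewrite ca chartK ?inE// -ca.
Qed.

Lemma riemannian_dist_cvg (u : nat -> M) p :
  riemannian_dist g (u n) p @[n --> \oo] --> 0%E -> u @ \oo --> p.
Proof.
move=> up U /riemannian_dist_nbhs[e e0 eU].
have near0 : nbhs (0%E : \bar R) [set x | (x < e%:E)%E].
  by apply: open_nbhs_nbhs; split; [exact: open_ereal_lt_ereal|rewrite /= lte_fin].
have near_n : \forall n \near \oo, (riemannian_dist g (u n) p < e%:E)%E.
  exact: (up _ near0).
suff : \forall n \near \oo, U (u n) by [].
by apply: filterS near_n => n; exact: eU.
Qed.

End riemannian_topology.

(** * Series of bumps *)

Section bump_series.
Context {R : realType} {H : normedModType R} {M : topologicalType}.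
Variables (X : manifold H M) (g : riemannian_metric X).

Lemma C1_function_cst0 : C1_function X (cst 0).
Proof.
apply/C1_functionP => i y _.
have d0 z : 'd (cst 0 \o chart_inv i : H -> R^o) z = 0 :> (H -> R^o).
  exact: (diff_cst (0 : R^o) z).
split; first exact: (differentiable_cst (0 : R^o) y).
by move=> d d0'; apply: nearW => z v _; rewrite !d0 subrr normr0 ltW.
Qed.

Lemma le0_geometric (t c z : R) : 0 <= z < 1 ->
  (forall n, t <= geometric c z n) -> t <= 0.
Proof.
move=> /andP[z0 z1] tc; have cv : geometric c z @ \oo --> 0.
  by apply: cvg_geometric; rewrite ger0_norm.
apply: (@closed_cvg _ _ _ eventually_filter _ [set s | t <= s] _ _ _ cv).
  exact: closed_ge.
by apply: nearW.
Qed.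

Lemma cvg_geometricV (c : R) (k : nat) :
  geometric c (k.+2%:R)^-1 @ \oo --> 0.
Proof.
by apply: cvg_geometric; rewrite ger0_norm ?invr_ge0// invf_lt1// ltr1n.
Qed.

Lemma geometric_half_bounds (c : R) (n : nat) : 0 < c ->
  0 < geometric c 2^-1 n <= c.
Proof.
move=> c0; rewrite /= mulr_gt0 ?exprn_gt0//= ger_pMr// exprn_ile1//.
by rewrite invf_le1// ler1n.
Qed.

Lemma geometric_half_small (c e : R) : 0 < e -> exists n, geometric c 2^-1 n < e.
Proof.
move=> e0; have /cvgrPdist_lt /(_ e e0) := @cvg_geometricV c 0.
case=> n _ /(_ n (leqnn n)); rewrite sub0r normrN.
by move=> /(le_lt_trans (ler_norm _)); exists n.
Qed.

(** A series of bumps whose supports shrink like 2^-n and whose heights decrease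
    like 8^-n: the gradients are then of order 4^-n, and both the heights and
    the gradients have remainders dominated by their first term. *)
Lemma bump_series (K rho al : R) (b s : nat -> M -> R) :
  0 <= K -> 0 < rho -> 0 < al ->
  (forall n, C1_function X (b n)) ->
  (forall n x, 0 <= b n x <= 1) ->
  (forall n, gradient_le g (b n) (K / geometric rho 2^-1 n)) ->
  s 0%N = cst 0 ->
  (forall n, s n.+1 = s n \+ (geometric al 8^-1 n \*o b n)) ->
  exists f : M -> R,
    [/\ C1_function X f,
        forall m n x, (n <= m)%N -> s n x <= s m x,
        forall n x, s n x <= f x <= s n x + 2 * geometric al 8^-1 n
      & gradient_le g f (2 * (al * K / rho))].
Proof.
move=> K0 rho0 al0 Cb b01 gb s0 sS.
pose a := geometric al 8^-1; pose e := geometric (2 * (al * K / rho)) 4^-1.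
have a0 n : 0 < a n by rewrite /a /= mulr_gt0// exprn_gt0.
have aS n : a n.+1 = a n / 8 by rewrite /a /= exprSr mulrA.
have c0 : 0 <= al * K / rho by rewrite divr_ge0 ?mulr_ge0// ltW.
have e_ge0 n : 0 <= e n by rewrite /e /= mulr_ge0 ?exprn_ge0// mulr_ge0.
have eS n : e n.+1 = e n / 4 by rewrite /e /= exprSr mulrA.
have aK n : a n * (K / geometric rho 2^-1 n) = e n / 2.
  rewrite /a /e /=.
  have -> : (8 : R)^-1 ^+ n = 4^-1 ^+ n * 2^-1 ^+ n.
    by rewrite -exprMn; congr (_ ^+ n); field.
  have t0 : (2 : R)^-1 ^+ n != 0 by rewrite expf_neq0// invr_eq0.
  set t := (2 : R)^-1 ^+ n in t0 *; set q := (4 : R)^-1 ^+ n.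
  by field; rewrite t0 gt_eqF.
have Cs n : C1_function X (s n).
  elim: n => [|n IH]; first by rewrite s0; exact: C1_function_cst0.
  by rewrite sS; exact: (C1_functionD IH (C1_functionZ (a n) (Cb n))).
have sSx n x : s n.+1 x = s n x + a n * b n x by rewrite sS.
have s_le m n x : (n <= m)%N -> s n x <= s m x.
  move=> /subnK <-; elim: (m - n)%N => [|k IH]; first by rewrite add0n.
  rewrite addSn sSx (le_trans IH)// lerDl mulr_ge0//; first exact: ltW.
  by have /andP[] := b01 (k + n)%N x.
have s_ub m n x : (n <= m)%N -> s m x + 2 * a m <= s n x + 2 * a n.
  move=> /subnK <-; elim: (m - n)%N => [|k IH]; first by rewrite add0n.
  rewrite addSn sSx aS; apply: le_trans IH.
  have /andP[_ b1] := b01 (k + n)%N x; have ak := a0 (k + n)%N.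
  have : a (k + n)%N * b (k + n)%N x <= a (k + n)%N by rewrite ler_piMr// ltW.
  lra.
have s_grad m n : (n <= m)%N -> gradient_le g (s m \- s n) (e n - e m).
  move=> /subnK <-; elim: (m - n)%N => [|k IH].
    have -> : s (0 + n)%N \- s n = 0 \*o s n.
      by apply/funext => x /=; rewrite add0n subrr mul0r.
    move=> p v; rewrite differentialZ// mul0r normr0 add0n subrr.
    by rewrite mul0r.
  have -> : s (k.+1 + n)%N \- s n =
      (s (k + n)%N \- s n) \+ (a (k + n)%N \*o b (k + n)%N).
    by apply/funext => x /=; rewrite addSn sSx addrAC.
  apply: (@gradient_leW _ _ _ _ _ _ (e n - e (k + n)%N + e (k + n)%N / 2)).
    by rewrite addSn eS; have := e_ge0 (k + n)%N; lra.
  have := gradient_leZ (a (k + n)%N) (Cb (k + n)%N) (gb (k + n)%N).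
  rewrite (ger0_norm (ltW (a0 _))) aK.
  apply: gradient_leD; [|exact: C1_functionZ|exact: IH].
  exact: (C1_functionB (Cs (k + n)%N) (Cs n)).
have cvg_s x : cvgn (fun n => s n x).
  apply: nondecreasing_is_cvgn; first by move=> n m nm; exact: s_le.
  exists (2 * a 0%N) => _ [n _ <-].
  have := s_ub n 0%N x (leq0n n); rewrite s0 /= add0r; apply: le_trans.
  by rewrite lerDl mulr_ge0// ltW.
pose f x := limn (fun n => s n x).
have s_f n x : s n x <= f x <= s n x + 2 * a n.
  apply/andP; split.
    apply: (@closed_cvg _ _ _ eventually_filter _ [set t | s n x <= t] _ _ _ (cvg_s x)).
      exact: closed_ge.
    by exists n => // m /= nm; exact: s_le.
  apply: (@closed_cvg _ _ _ eventually_filter _ [set t | t <= s n x + 2 * a n] _ _ _ (cvg_s x)).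
    exact: closed_le.
  exists n => // m /= nm; apply: le_trans (s_ub m n x nm).
  by rewrite lerDl mulr_ge0// ltW.
have e_cvg : e @ \oo --> 0 by exact: cvg_geometricV.
have [Cf df] : C1_function X f /\
    forall p v, differential X (s n) p v @[n --> \oo] --> differential X f p v.
  apply: (@C1_function_limit _ _ _ _ g s f e) => // m n nm.
  by apply: gradient_leW (s_grad m n nm); rewrite lerBlDr lerDl.
exists f; split => // p v.
rewrite -[X in `|X|]subr0; apply: (@cvg_dist_le _ _ _ _ _ 0%N (df p v)) => m _.
rewrite subr0; have := s_grad m 0%N (leq0n m).
have -> : s m \- s 0%N = s m by apply/funext => x /=; rewrite s0 subr0.
move=> /(_ p v) /le_trans; apply; rewrite ler_wpM2r ?tnorm_ge0//.
by rewrite {1}/e /= expr0 mulr1 lerBlDr lerDl.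
Qed.

End bump_series.

(** * Perturbed minimization *)

Section perturbation.
Context {R : realType} {H : completeNormedModType R} {M : topologicalType}.
Variables (ip : {dot H for idfun}) (ip_norm : induces_norm ip).
Variables (X : manifold H M) (g : riemannian_metric X).

Definition is_bump (K : R) (p : M) (d : R) (b : M -> R) : Prop :=
  [/\ C1_function X b, forall x, 0 <= b x <= 1, b p = 1,
      forall x, (d%:E <= riemannian_dist g x p)%E -> b x = 0
    & gradient_le g b (K / d)].

Lemma approximate_minimum (F : M -> \bar R) (f : M -> R) (eta : R) :
  (forall x, (-oo < F x)%E) ->
  (exists m : R, forall x, (m%:E <= F x)%E) ->
  (exists x, F x <> +oo%E) ->
  exists q, (exists k : R, forall x, f x <= k) -> 0 < eta ->
    F q \is a fin_num /\
    forall x, (F q - (f q)%:E <= F x - (f x)%:E + eta%:E)%E.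
Proof.
move=> FNy [m Fm] [x0 Fx0].
have F_fin x : F x <> +oo%E -> F x \is a fin_num.
  move=> Fx; rewrite fin_numE; have := FNy x; rewrite ltNye => ->.
  by apply/eqP.
have [[[k fk] eta0]|] := pselect ((exists k : R, forall x, f x <= k) /\ 0 < eta);
  last by move=> bad; exists x0 => ? ?; exfalso; exact: bad.
pose A := [set fine (F x) - f x | x in [set x | F x <> +oo%E]].
have infA : has_inf A.
  split; first by exists (fine (F x0) - f x0), x0.
  exists (m - k) => _ [x /= Fx <-]; apply: lerB => //.
  by rewrite -lee_fin fineK ?F_fin.
have [_ [q /= Fq <-] qA] := inf_adherent eta0 infA.
exists q => _ _; split; first exact: F_fin.
move=> x; have [->|/eqP Fx] := eqVneq (F x) +oo%E.
  by rewrite !addye// leey.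
rewrite -(fineK (F_fin _ Fq)) -(fineK (F_fin _ Fx)) -!EFinB -EFinD lee_fin.
have : inf A <= fine (F x) - f x by apply: ge_inf; [exact: (proj2 infA)|exists x].
by move: qA; lra.
Qed.

(** Existence of a minimum after a small perturbation. The n-th bump is centred
    at an approximate minimizer [p n] of the function perturbed so far, with an
    error of half its height [a n]. A later approximate minimizer outside the
    support of this bump would gain at most the total height of the later
    bumps, which is below [a n / 4], plus the approximation errors, while [p n]
    has gained [a n]; so that the [p n] form a Cauchy sequence, and its
    limit is a minimizer by semicontinuity. *)
Lemma perturbed_minimum (K rho al : R) (B : M -> R -> M -> R) (F : M -> \bar R) :
  0 <= K -> 0 < rho -> 0 < al ->
  (forall p d, 0 < d <= rho -> is_bump K p d (B p d)) ->
  riemannian_complete g ->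
  (forall x, (-oo < F x)%E) -> lower_semicontinuous F ->
  (exists m : R, forall x, (m%:E <= F x)%E) ->
  (exists x, F x <> +oo%E) ->
  exists f : M -> R,
    [/\ C1_function X f, forall x, 0 <= f x <= 2 * al,
        gradient_le g f (2 * (al * K / rho))
      & exists2 l, F l \is a fin_num &
          forall x, (F l - (f l)%:E <= F x - (f x)%:E)%E].
Proof.
move=> K0 rho0 al0 bumpB complete FNy Flsc Fm Fproper.
pose a := geometric al 8^-1; pose d := geometric rho 2^-1.
have a0 n : 0 < a n by rewrite /a /= mulr_gt0// exprn_gt0.
have aS n : a n.+1 = a n / 8 by rewrite /a /= exprSr mulrA.
have a_le m n : (n <= m)%N -> a m <= a n.
  move=> nm; rewrite /a /= ler_pM2l// ler_wiXn2l// invf_le1// ler1n.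
  by [].
have d0 n : 0 < d n <= rho by exact: geometric_half_bounds.
have [P P_min] := choice (fun fe : (M -> R) * R =>
  @approximate_minimum F fe.1 fe.2 FNy Fm Fproper).
pose s := nat_rect (fun _ => M -> R) (cst 0)
  (fun n sn => sn \+ (a n \*o B (P (sn, a n / 2)) (d n))).
pose p n := P (s n, a n / 2).
pose b n := B (p n) (d n).
have bumpb n : is_bump K (p n) (d n) (b n) by exact: bumpB.
have [f [Cf s_le s_f gf]] : exists f : M -> R,
    [/\ C1_function X f, forall m n x, (n <= m)%N -> s n x <= s m x,
        forall n x, s n x <= f x <= s n x + 2 * a n
      & gradient_le g f (2 * (al * K / rho))].
  apply: (@bump_series _ _ _ _ g K rho al b s) => // n.
  - by have [] := bumpb n.
  - by have [] := bumpb n.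
  - by have [] := bumpb n.
have s0 x : s 0%N x = 0 by [].
have sS n x : s n.+1 x = s n x + a n * b n x by [].
have a0E : a 0%N = al by rewrite /a /= expr0 mulr1.
have f_bound x : 0 <= f x <= 2 * al.
  by have := s_f 0%N x; rewrite s0 add0r a0E.
have p_min n : F (p n) \is a fin_num /\ forall x,
    (F (p n) - (s n (p n))%:E <= F x - (s n x)%:E + (a n / 2)%:E)%E.
  apply: (P_min (s n, a n / 2)) => /=; last by rewrite divr_gt0.
  exists (2 * al) => x; have /andP[sf _] := s_f n x.
  by apply: le_trans sf _; have /andP[] := f_bound x.
have p_close m n : (n <= m)%N -> (riemannian_dist g (p m) (p n) < (d n)%:E)%E.
  move=> nm; rewrite ltNge; apply/negP => far.
  have [_ _ b1 b0 _] := bumpb n; have bm := b0 _ far.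
  move: nm; rewrite leq_eqVlt => /predU1P[nm|nm].
    by move: bm b1; rewrite -nm => ->; apply/eqP; rewrite eq_sym oner_eq0.
  have [Fn_fin n_min] := p_min n; have [Fm_fin m_min] := p_min m.
  have := n_min (p m); have := m_min (p n).
  rewrite -(fineK Fn_fin) -(fineK Fm_fin) -!EFinB -!EFinD !lee_fin.
  have := s_le m n.+1 (p n) nm; rewrite sS b1 mulr1.
  have /andP[_] := s_f n.+1 (p m); rewrite sS bm mulr0 addr0 aS.
  have /andP[+ _] := s_f m (p m).
  have := a_le m n.+1 nm; rewrite aS; have := a0 n.
  by lra.
have d_le m n : (n <= m)%N -> d m <= d n.
  move=> nm; rewrite /d /= ler_pM2l// ler_wiXn2l// invf_le1// ler1n.
  by [].
have [l pl] : exists l : M, riemannian_dist g (p n) l @[n --> \oo] --> 0%E.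
  apply: complete => e e0; have [N dN] := geometric_half_small rho e0; exists N => m n Nm Nn.
  have dE k : (N <= k)%N -> ((d k)%:E < e%:E)%E.
    by move=> Nk; rewrite lte_fin (le_lt_trans (d_le k N Nk)).
  have [nm|mn] := leqP n m; first exact: lt_trans (p_close m n nm) (dE n Nn).
  rewrite riemannian_distC.
  exact: lt_trans (p_close n m (ltnW mn)) (dE m Nm).
have {}pl : p @ \oo --> l by exact: riemannian_dist_cvg ip_norm _ _ _ _ pl.
have fpl : f (p n) @[n --> \oo] --> f l.
  by apply: cvg_comp pl _; exact: (C1_continuous Cf).
have le_fin_point x (A : R) : F x <> +oo%E -> (A%:E < F l)%E ->
    A - f l <= fine (F x) - f x.
  move=> Fx Al; have [V Vl VF] := Flsc l A Al.
  have Fx_fin : F x \is a fin_num.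
    by rewrite fin_numE; have := FNy x; rewrite ltNye => ->; apply/eqP.
  have near_A : \forall n \near \oo, A - f (p n) - 3 * a n <= fine (F x) - f x.
    have near_V : \forall n \near \oo, V (p n) by exact: pl.
    apply: filterS near_V => n /VF; have [Fn_fin /(_ x)] := p_min n.
    rewrite -(fineK Fn_fin) -(fineK Fx_fin) -!EFinB -!EFinD lee_fin lte_fin.
    have /andP[+ _] := s_f n (p n); have /andP[_] := s_f n x.
    by have := a0 n; lra.
  have cvg_A : A - f (p n) - 3 * a n @[n --> \oo] --> A - f l - 3 * 0.
    apply: cvgB; first by apply: cvgB => //; exact: cvg_cst.
    by apply: cvgMl_tmp; exact: cvg_geometricV.
  rewrite mulr0 subr0 in cvg_A.
  apply: (@closed_cvg _ _ _ eventually_filter _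
    [set t | t <= fine (F x) - f x] _ _ _ cvg_A).
    exact: closed_le.
  exact: near_A.
have le_point x : F x <> +oo%E -> (F l <= (fine (F x) - f x + f l)%:E)%E.
  move=> Fx; rewrite leNgt; apply/negP.
  set v := fine (F x) - f x + f l => vl.
  have [A vA Al] : exists2 A : R, v < A & (A%:E < F l)%E.
    move: vl; case: (F l) => [r| |//].
      rewrite lte_fin => vr; exists ((v + r) / 2); last rewrite lte_fin.
        by lra.
      by lra.
    by move=> _; exists (v + 1); [rewrite ltrDl|rewrite ltry].
  by have := le_fin_point x A Fx Al; move: vA; rewrite /v; lra.
have Fl_fin : F l \is a fin_num.
  have [x0 Fx0] := Fproper; rewrite fin_numE; have := FNy l; rewrite ltNye => ->.
  apply/eqP => Fl; have := le_point x0 Fx0.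
  by rewrite Fl leye_eq.
exists f; split => //; exists l => // x.
have [->|/eqP Fx] := eqVneq (F x) +oo%E; first by rewrite addye// leey.
have Fx_fin : F x \is a fin_num.
  by rewrite fin_numE; have := FNy x; rewrite ltNye => ->; apply/eqP.
have := le_point x Fx.
rewrite -(fineK Fl_fin) -(fineK Fx_fin) -!EFinB !lee_fin /=.
by lra.
Qed.

(** A series of bumps that are all centred at [l]. A point outside the n-th
    ball misses the n-th bump, and the later ones cannot make up for it. Adding
    this function turns a minimum at [l] into a strong one. *)
Lemma strong_maximum_function (K rho al : R) (B : M -> R -> M -> R) (l : M) :
  0 <= K -> 0 < rho -> 0 < al ->
  (forall p d, 0 < d <= rho -> is_bump K p d (B p d)) ->
  exists f : M -> R,
    [/\ C1_function X f, forall x, 0 <= f x <= 2 * al,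
        gradient_le g f (2 * (al * K / rho)),
        forall x, f x <= f l
      & forall e : R, 0 < e -> exists2 c : R, 0 < c & forall x,
          f l - c < f x -> (riemannian_dist g x l < e%:E)%E].
Proof.
move=> K0 rho0 al0 bumpB.
pose a := geometric al 8^-1; pose d := geometric rho 2^-1.
have a0 n : 0 < a n by rewrite /a /= mulr_gt0// exprn_gt0.
have aS n : a n.+1 = a n / 8 by rewrite /a /= exprSr mulrA.
have d0 n : 0 < d n <= rho by exact: geometric_half_bounds.
pose b n := B l (d n).
pose s := nat_rect (fun _ => M -> R) (cst 0) (fun n sn => sn \+ (a n \*o b n)).
have bumpb n : is_bump K l (d n) (b n) by exact: bumpB.
have [f [Cf s_le s_f gf]] : exists f : M -> R,
    [/\ C1_function X f, forall m n x, (n <= m)%N -> s n x <= s m x,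
        forall n x, s n x <= f x <= s n x + 2 * a n
      & gradient_le g f (2 * (al * K / rho))].
  apply: (@bump_series _ _ _ _ g K rho al b s) => // n.
  - by have [] := bumpb n.
  - by have [] := bumpb n.
  - by have [] := bumpb n.
have s0 x : s 0%N x = 0 by [].
have sS n x : s n.+1 x = s n x + a n * b n x by [].
have sl n x : s n x <= s n l.
  elim: n => [//|n IH]; rewrite !sS lerD// ler_pM2l//.
  by have [_ /(_ x)/andP[_ b1] -> _ _] := bumpb n.
exists f; split => //.
- by move=> x; have := s_f 0%N x; rewrite s0 add0r /a /= expr0 mulr1.
- move=> x; rewrite -subr_le0; apply: (@le0_geometric _ _ (2 * al) 8^-1).
    by rewrite invr_ge0 ler0n invf_lt1// ltr1n.
  move=> n; have /andP[_] := s_f n x; have /andP[+ _] := s_f n l.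
  rewrite /= -mulrA -[al * _]/(a n).
  by have := sl n x; lra.
- move=> e e0.
  have [n dn] := geometric_half_small rho e0; rewrite -/(d n) in dn.
  exists (a n / 2); first by rewrite divr_gt0.
  move=> x fx; rewrite ltNge; apply/negP => far.
  have [_ _ b1 b0 _] := bumpb n.
  have bx : b n x = 0.
    by apply: b0; apply: le_trans far; rewrite lee_fin ltW.
  have /andP[+ _] := s_f n.+1 l; rewrite sS b1 mulr1.
  have /andP[_] := s_f n.+1 x; rewrite sS bx mulr0 addr0 aS.
  by move: fx (sl n x) (a0 n); lra.
Qed.

End perturbation.

Theorem theorem3p11 (R : realType) (H : completeNormedModType R)
  (ip : {dot H for idfun}) (ip_norm : induces_norm ip)
  (M : topologicalType) (X : manifold H M) (g : riemannian_metric X)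
  (g_complete : riemannian_complete g)
  (g_bumpable : uniformly_bumpable g)
  (F : M -> \bar R)
  (F_gtNy : forall x : M, (-oo < F x)%E)
  (F_lsc : lower_semicontinuous F)
  (F_bounded_below : exists m : R, forall x : M, (m%:E <= F x)%E)
  (F_proper : exists x : M, F x <> +oo%E)
  (delta : R) (delta_gt0 : 0 < delta) :
  exists phi : M -> R,
    [/\ C1_function X phi,
        exists K : R, forall x : M, `|phi x| <= K,
        exists p : M, strong_minimum g (fun x => (F x - (phi x)%:E)%E) p,
        (ereal_sup (range (fun x : M => `|phi x|%:E)) < delta%:E)%E
      & (ereal_sup (range (differential_norm g phi)) < delta%:E)%E].
Proof.
have [K [r [K1 r0 bumps]]] := g_bumpable.
have K0 : 0 < K by exact: lt_trans K1.
have [B bumpB] : exists B : M -> R -> M -> R,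
    forall p d, 0 < d <= r / 2 -> is_bump g K p d (B p d).
  have /choice[B BP] (pd : M * R) :
      exists b, 0 < pd.2 <= r / 2 -> is_bump g K pd.1 pd.2 b.
    have [/andP[d0 dr]|bad] := pselect (0 < pd.2 <= r / 2); last first.
      by exists (cst 0) => /bad.
    have [|b [Cb b01 b1 b0 gb]] := bumps pd.1 pd.2.
      by rewrite d0 (le_lt_trans dr)// ltr_pdivrMr// ltr_pMr// ltr1n.
    exists b => _; split => //; apply/gradient_leP => //.
    by rewrite divr_ge0 ?ltW.
  by exists (fun p d => B (p, d)) => p d; exact: (BP (p, d)).
have r2 : 0 < r / 2 by rewrite divr_gt0.
(* The two perturbations are allowed a quarter of delta each, in value and in
   gradient; the total stays below delta / 2. *)
have [al [al0 al_h al_g]] : exists al : R,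
    [/\ 0 < al, 2 * al <= delta / 4 & 2 * (al * K / (r / 2)) <= delta / 4].
  exists (Num.min (delta / 8) (delta / 8 * ((r / 2) / K))); split.
  - by rewrite lt_min !mulr_gt0// ?invr_gt0.
  - have : Num.min (delta / 8) (delta / 8 * ((r / 2) / K)) <= delta / 8.
      by rewrite ge_min lexx.
    by lra.
  - set m := Num.min _ _.
    have : m * K / (r / 2) <= delta / 8.
      rewrite ler_pdivrMr// -ler_pdivlMr// -mulrA /m ge_min.
      by rewrite lexx orbT.
    by lra.
have [f [Cf f_bound gf [l Fl l_min]]] := perturbed_minimum ip_norm (ltW K0) r2
  al0 bumpB g_complete F_gtNy F_lsc F_bounded_below F_proper.
have [h [Ch h_bound gh h_max h_strong]] :=
  strong_maximum_function l (ltW K0) r2 al0 bumpB.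
have phi_bound x : `|f x + h x| <= delta / 2.
  have /andP[f0 f1] := f_bound x; have /andP[h0 h1] := h_bound x.
  by rewrite ger0_norm ?addr_ge0//; lra.
have delta2 : ((delta / 2)%:E < delta%:E)%E by rewrite lte_fin; lra.
have l_min_phi x : (F l - (f l + h l)%:E <= F x - (f x + h x)%:E)%E.
  have [->|/eqP Fx] := eqVneq (F x) +oo%E; first by rewrite addye// leey.
  have Fx_fin : F x \is a fin_num.
    by rewrite fin_numE; have := F_gtNy x; rewrite ltNye => ->; apply/eqP.
  have := l_min x; have := h_max x.
  by rewrite -(fineK Fl) -(fineK Fx_fin) -!EFinB !lee_fin; lra.
exists (f \+ h); split.
- exact: C1_functionD.
- by exists (delta / 2).
- exists l; split.
    apply/eqP; rewrite eq_le; apply/andP; split.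
      by apply: le_ereal_inf_tmp => _ [x _ <-]; exact: l_min_phi.
    by apply: ereal_inf_lbound; exists l.
  move=> u u_min U U0.
  have [e /= e0 eU] : exists2 e : R, 0 < e & forall t, `|t| < e -> U t%:E.
    have [e e0 eU] := (nbhs_ballP _ _).1 (U0 : nbhs (0 : R) (fun t => U t%:E)).
    exists e => // t te; apply: eU.
    by rewrite -ball_normE /= sub0r normrN.
  have [c c0 hc] := h_strong e e0.
  have near_c : \forall n \near \oo,
      (F (u n) - (f (u n) + h (u n))%:E < F l - (f l + h l)%:E + c%:E)%E.
    apply: (u_min [set y | (y < F l - (f l + h l)%:E + c%:E)%E]).
    apply: open_nbhs_nbhs; split; first exact: open_ereal_lt_ereal.
    by rewrite /= -(fineK Fl) -EFinB -EFinD lte_fin ltrDl.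
  suff : \forall n \near \oo, U (riemannian_dist g (u n) l) by [].
  apply: filterS near_c => n u_c.
  have Fu : F (u n) \is a fin_num.
    rewrite fin_numE; have := F_gtNy (u n); rewrite ltNye => -> /=.
    by apply/eqP => Fu; move: u_c; rewrite Fu addye// ltNge leey.
  have d_e : (riemannian_dist g (u n) l < e%:E)%E.
    apply: hc; have := l_min (u n); move: u_c.
    rewrite -(fineK Fl) -(fineK Fu) -!EFinB -EFinD lte_fin lee_fin.
    by lra.
  have d0 := riemannian_dist_ge0 g (u n) l.
  have d_fin : riemannian_dist g (u n) l \is a fin_num.
    by rewrite ge0_fin_numE// (lt_trans d_e)// ltey.
  rewrite -(fineK d_fin); apply: eU.
  by rewrite ger0_norm ?fine_ge0// -lte_fin fineK.
- apply: le_lt_trans delta2; apply: ge_ereal_sup => _ [x _ <-].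
  by rewrite lee_fin; exact: phi_bound.
- apply: le_lt_trans delta2; apply/gradient_leP; first by rewrite divr_ge0// ltW.
  apply: gradient_leW (gradient_leD Cf Ch gf gh).
  by lra.
Qed.
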